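(* Let $a,b\in\mathbb{C}\setminus\{0\}$, $c>0$, and $c>|a|+|b|+2$. Suppose that $$\frac{\Gamma(c)\,\Gamma(c-|a|-|b|)}{\Gamma(|b|)\,\Gamma(c-|b|)}\Bigg[\frac{2(|a|)_2}{(c-|a|-|b|-2)_2}\sum_{n=0}^{\infty}\binom{-(|a|+2)}{n}\frac{\Gamma(|b|+8+2n)}{\Gamma(c-|a|+6+2n)}\;{}_2F_1(|a|+2,|b|+8+2n;c-|a|+6+2n;-1)$$ $$+\frac{5|a|}{c-|a|-|b|-1}\sum_{n=0}^{\infty}\binom{-(|a|+1)}{n}\frac{\Gamma(|b|+4+2n)}{\Gamma(c-|a|+3+2n)}\;{}_2F_1(|a|+1,|b|+4+2n;c-|a|+3+2n;-1)$$ $$+\sum_{n=0}^{\infty}\binom{-|a|}{n}\frac{\Gamma(|b|+2n)}{\Gamma(c-|a|+2n)}\;{}_2F_1(|a|,|b|+2n;c-|a|+2n;-1)\Bigg]\le 2 .$$ Then the function $z\;{}_5F_4\left(a,\tfrac{b}{4},\tfrac{b+1}{4},\tfrac{b+2}{4},\tfrac{b+3}{4};\tfrac{c}{4},\tfrac{c+1}{4},\tfrac{c+2}{4},\tfrac{c+3}{4};z\right)$ belongs to the class $\mathcal{UCV}$.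
   Context: $\mathbb{D}=\{z\in\mathbb{C}:|z|<1\}$. $\mathcal{A}$ is the family of functions $f(z)=z+\sum_{n\ge2}a_nz^n$ analytic in $\mathbb{D}$, and $\mathcal{S}\subset\mathcal{A}$ is the subclass of univalent functions. $\mathcal{UCV}$ (uniformly convex functions) is the class of $f\in\mathcal{S}$ with $\mathrm{Re}\left(1+\frac{(z-\zeta)f''(z)}{f'(z)}\right)>0$ for all $\zeta,z\in\mathbb{D}$; equivalently $\left|\frac{zf''(z)}{f'(z)}\right|<\mathrm{Re}\left(1+\frac{zf''(z)}{f'(z)}\right)$ for all $z\in\mathbb{D}$. Pochhammer symbol: $(x)_0=1$, $(x)_n=x(x+1)\cdots(x+n-1)$; generalized binomial coefficient $\binom{-x}{n}=(-1)^n(x)_n/n!$. ${}_5F_4(a_1,\dots,a_5;b_1,\dots,b_4;z)=\sum_{n\ge0}\frac{(a_1)_n\cdots(a_5)_n}{(b_1)_n\cdots(b_4)_n\,(1)_n}z^n$ for $|z|<1$; ${}_2F_1(p,q;r;z)=\sum_{k\ge0}\frac{(p)_k(q)_k}{(r)_k(1)_k}z^k$ for $|z|<1$, extended as usual by analytic continuation to $z=-1$. *)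

(* Defs.v *)
From Stdlib Require Import Reals List Factorial.
From Coquelicot Require Export Coquelicot.
Export ListNotations.

Open Scope R_scope.

(* Only meaningful for 0 < x, where the improper integral converges. *)
Definition Gamma (x : R) : R :=
  RInt_gen (fun t => Rpower t (x - 1) * exp (- t))
    (at_right 0) (Rbar_locally p_infty).

Fixpoint pochR (x : R) (n : nat) : R :=
  match n with
  | O => 1
  | S m => pochR x m * (x + INR m)
  end.

Fixpoint pochC (x : C) (n : nat) : C :=
  match n with
  | O => RtoC 1
  | S m => (pochC x m * (x + RtoC (INR m)))%C
  end.

Definition gbinom (y : R) (n : nat) : R :=
  (-1) ^ n * pochR (- y) n / INR (fact n).

Definition Cprod (l : list C) : C := fold_right Cmult (RtoC 1) l.

Definition pFq_coef (us ls : list C) (n : nat) : C :=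
  (Cprod (map (fun u => pochC u n) us)
   / (Cprod (map (fun l => pochC l n) ls) * pochC (RtoC 1) n))%C.

(* Sum of the hypergeometric power series. [iota] picks the unique value
   satisfying the predicate, so this is meaningful where the series converges,
   in particular for |z| < 1 when there is one more upper than lower parameter
   and no lower parameter is a nonpositive integer. *)
Definition pFq (us ls : list C) (z : C) : C :=
  iota (T := C_CompleteNormedModule)
    (is_pseries (K := C_AbsRing) (V := C_NormedModule) (pFq_coef us ls) z).

Definition holomorphic_on (D : C -> Prop) (f : C -> C) : Prop :=
  forall z, D z -> ex_derive (K := C_AbsRing) (V := C_NormedModule) f z.

Definition Cdisc (z0 : C) (r : R) (z : C) : Prop := Cmod (z - z0)%C < r.

Definition unit_disc (z : C) : Prop := Cmod z < 1.

(* The function f, analytic on the open unit disc, continues analytically to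
   the point z0 with value w there. For |z0| <= 1 such a w is unique: it is the
   limit of f at z0 from inside the disc. *)
Definition continues_to (f : C -> C) (z0 w : C) : Prop :=
  exists (r : R) (g : C -> C),
    0 < r /\
    holomorphic_on (Cdisc z0 r) g /\
    (forall z, Cdisc z0 r z -> unit_disc z -> g z = f z) /\
    g z0 = w.

(* For |z| < 1 this is the sum of the series; at a boundary point of the disc
   other than 1, such as -1, it is the value of the analytic continuation. *)
Definition hyp2F1 (p q r z : C) : C :=
  iota (T := C_CompleteNormedModule) (continues_to (pFq [p; q] [r]) z).

Definition class_A (f : C -> C) : Prop :=
  holomorphic_on unit_disc f /\
  exists u : nat -> C,
    u 0%nat = RtoC 0 /\ u 1%nat = RtoC 1 /\
    forall z, unit_disc z ->
      is_pseries (K := C_AbsRing) (V := C_NormedModule) u z (f z).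

Definition class_S (f : C -> C) : Prop :=
  class_A f /\
  forall z w, unit_disc z -> unit_disc w -> f z = f w -> z = w.

Definition class_UCV (f : C -> C) : Prop :=
  class_S f /\
  forall zeta z, unit_disc zeta -> unit_disc z ->
    0 < Re (RtoC 1 + (z - zeta) * C_derive (C_derive f) z / C_derive f z)%C.

(* The n-th term of each of the three series in the hypothesis:
   binom(-alpha, n) Gamma(beta + 2n) / Gamma(gamma + 2n)
     * 2F1(alpha, beta + 2n; gamma + 2n; -1). *)
Definition gamma_2F1_term (alpha beta gamma : R) (n : nat) : C :=
  (RtoC (gbinom (- alpha) n
         * (Gamma (beta + 2 * INR n) / Gamma (gamma + 2 * INR n)))
   * hyp2F1 (RtoC alpha) (RtoC (beta + 2 * INR n))
       (RtoC (gamma + 2 * INR n)) (RtoC (-1)))%C.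

(* Main.v *)
(** The coefficients of the function are dominated by
    B_n = (|a|)_n (|b|)_4n / ((c)_4n n!), and sum_(k >= 2) k (2k - 1) |u_k| <= 1 suffices
    for z + sum_(k >= 2) u_k z^k to be uniformly convex, so it is enough to show
    sum_n (n + 1) (2n + 1) B_n <= 2. Writing (n + 1) (2n + 1) = 2 n (n - 1) + 5 n + 1 and
    shifting indices splits this sum into three sums of the type of sum_n B_n.

    Since (beta)_m / (beta + d)_m is the m-th moment of the beta distribution, whose mean
    value functional is written L, the terms of each series of the hypothesis are, up to
    a constant, binom(-alpha, n) L(t^2n (1 + t)^-alpha): Euler's integral represents the
    analytic continuation of 2F1 at -1. By Abel's theorem and positivity of L the series
    is at least L((1 + t)^-alpha (1 + t^2)^-alpha), which dominates
    L((1 - t)^alpha sum_(n <= N) (alpha)_n t^4n / n!), a multiple of the N-th partial sum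
    of B_n; the constant is a quotient of beta integrals, expressed by Gamma values. *)

Require Import Defs.
From Stdlib Require Import Reals List.
From Coquelicot Require Import Coquelicot.
From Stdlib Require Import Lra Lia Factorial.
Open Scope R_scope.

(** * Improper integrals on intervals with left end point 0 *)

Class interval_from_0 (Fb : (R -> Prop) -> Prop) (P : R -> Prop) : Prop := {
  ifz_proper :: ProperFilter Fb;
  ifz_pos : forall x, P x -> 0 < x;
  ifz_convex : forall u v x, 0 < u -> P v -> u <= x <= v -> P x;
  ifz_end : forall m, P m -> Fb (fun v => m < v /\ P v);
  ifz_inh : exists m, P m }.

Global Instance interval_01 : interval_from_0 (at_left 1) (fun x => 0 < x < 1).
Proof.
split.
- apply at_left_proper_filter.
- intros; lra.
- intros; lra.
- intros m Hm. assert (He : 0 < 1 - m) by lra.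
  exists (mkposreal _ He). intros y Hy Hy1.
  change (Rabs (y - 1) < 1 - m) in Hy.
  apply Rabs_def2 in Hy. lra.
- exists (1/2); lra.
Qed.

Global Instance interval_0_infty :
  interval_from_0 (Rbar_locally p_infty) (fun x => 0 < x).
Proof.
split.
- apply Rbar_locally_filter.
- intros; lra.
- intros; lra.
- intros m Hm. exists m. intros; lra.
- exists 1; lra.
Qed.

Section Improper.
Context {Fb : (R -> Prop) -> Prop} {P : R -> Prop} {HP : interval_from_0 Fb P}.

Lemma filter_prod_interval (u0 v0 : R) : P u0 -> P v0 ->
  filter_prod (at_right 0) Fb
    (fun ab => 0 < fst ab < u0 /\ v0 < snd ab /\ P (snd ab)).
Proof.
intros Hu Hv.
apply Filter_prod with (Q := fun u => 0 < u < u0) (R := fun v => v0 < v /\ P v).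
- pose proof (ifz_pos _ Hu) as H0.
  exists (mkposreal _ H0). intros y Hy Hy0.
  change (Rabs (y - 0) < u0) in Hy. apply Rabs_def2 in Hy. lra.
- now apply ifz_end.
- intros u v; simpl; tauto.
Qed.

Lemma filter_prod_inside (Q : R -> Prop) : (forall x, P x -> Q x) ->
  filter_prod (at_right 0) Fb
    (fun ab => fst ab <= snd ab /\ forall x, fst ab <= x <= snd ab -> Q x).
Proof.
intros HQ. destruct (ifz_inh (P := P)) as [m Hm].
generalize (filter_prod_interval m m Hm Hm).
apply filter_imp. intros [u v]; simpl. intros [H1 [H2 H3]].
split; [lra|]. intros x Hx. apply HQ. eapply ifz_convex with u v; auto; lra.
Qed.

Lemma RInt_gen_interval_ext (f g : R -> R) (l : R) :
  (forall x, P x -> f x = g x) ->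
  is_RInt_gen f (at_right 0) Fb l -> is_RInt_gen g (at_right 0) Fb l.
Proof.
intros H. apply is_RInt_gen_ext; try apply filter_filter.
generalize (filter_prod_inside _ H). apply filter_imp.
intros [u v]; simpl. intros [H1 H2] x Hx. apply H2.
rewrite Rmin_left, Rmax_right in Hx by lra. lra.
Qed.

Lemma ex_RInt_inside (h : R -> R) (u v : R) :
  (forall x, P x -> continuous h x) -> P u -> P v -> ex_RInt h u v.
Proof.
intros Hc Hu Hv. apply (ex_RInt_continuous (V := R_CompleteNormedModule)).
intros z Hz. apply Hc.
assert (P (Rmin u v)) by (unfold Rmin; destruct (Rle_dec u v); auto).
assert (P (Rmax u v)) by (unfold Rmax; destruct (Rle_dec u v); auto).
eapply ifz_convex with (Rmin u v) (Rmax u v); auto. now apply ifz_pos.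
Qed.

Lemma ex_RInt_gen_nonneg (h : R -> R) (M : R) :
  (forall x, P x -> continuous h x) -> (forall x, P x -> 0 <= h x) ->
  (forall u v, P u -> P v -> u <= v -> RInt h u v <= M) ->
  ex_RInt_gen h (at_right 0) Fb.
Proof.
intros Hc Hp HM. destruct (ifz_inh (P := P)) as [m Hm].
destruct (completeness (fun s => exists u v, P u /\ P v /\ u <= v /\ s = RInt h u v))
  as [l [Hl1 Hl2]].
- exists M. intros s (u & v & Hu & Hv & Huv & ->). auto.
- exists (RInt h m m), m, m. repeat split; auto; lra.
- exists l. intros Q [eps HQ].
  assert (exists u0 v0, P u0 /\ P v0 /\ u0 <= v0 /\ l - eps < RInt h u0 v0)
    as (u0 & v0 & Hu0 & Hv0 & Huv0 & Hs).
  { apply Classical_Prop.NNPP. intros Hn.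
    assert (l <= l - eps); [|destruct eps; simpl in *; lra].
    apply Hl2. intros s (u & v & Hu & Hv & Huv & ->).
    apply Rnot_lt_le. intros Hlt. apply Hn. exists u, v. auto. }
  unfold filtermapi.
  generalize (filter_prod_interval u0 v0 Hu0 Hv0). apply filter_imp.
  intros [u v]; simpl. intros [H1 [H2 H3]].
  assert (Pu : P u) by (eapply ifz_convex with u v; auto; lra).
  exists (RInt h u v). split.
  { apply (RInt_correct (V := R_CompleteNormedModule)).
    now apply ex_RInt_inside. }
  apply HQ. change (Rabs (RInt h u v - l) < eps).
  assert (RInt h u v <= l).
  { apply Hl1. exists u, v. repeat split; auto; lra. }
  assert (RInt h u0 v0 <= RInt h u v).
  { rewrite <- (RInt_Chasles (V := R_CompleteNormedModule) h u u0 v) by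
      (now apply ex_RInt_inside).
    rewrite <- (RInt_Chasles (V := R_CompleteNormedModule) h u0 v0 v) by
      (now apply ex_RInt_inside).
    change plus with Rplus.
    assert (0 <= RInt h u u0).
    { apply RInt_ge_0; try lra. now apply ex_RInt_inside.
      intros x Hx. apply Hp. eapply ifz_convex with u u0; auto; lra. }
    assert (0 <= RInt h v0 v).
    { apply RInt_ge_0; try lra. now apply ex_RInt_inside.
      intros x Hx. apply Hp. eapply ifz_convex with v0 v; auto; lra. }
    lra. }
  apply Rabs_def1; lra.
Qed.

Lemma ex_RInt_gen_dominated_nonneg (h G g : R -> R) (M : R) :
  (forall x, P x -> continuous h x) ->
  (forall x, P x -> is_derive G x (g x)) ->
  (forall x, P x -> continuous g x) ->
  (forall x, P x -> 0 <= h x <= g x) ->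
  (forall x, P x -> Rabs (G x) <= M) ->
  ex_RInt_gen h (at_right 0) Fb.
Proof.
intros Hc HG Hg Hh HM.
apply ex_RInt_gen_nonneg with (2 * M); auto.
- intros x Hx. now apply Hh.
- intros u v Hu Hv Huv.
  assert (HI : is_RInt g u v (minus (G v) (G u))).
  { apply (is_RInt_derive (V := R_CompleteNormedModule)).
    - intros x Hx. apply HG. rewrite Rmin_left, Rmax_right in Hx by lra.
      eapply ifz_convex with u v; auto. now apply ifz_pos.
    - intros x Hx. apply Hg. rewrite Rmin_left, Rmax_right in Hx by lra.
      eapply ifz_convex with u v; auto. now apply ifz_pos. }
  apply Rle_trans with (RInt g u v).
  + apply RInt_le; auto. now apply ex_RInt_inside. now apply ex_RInt_inside.
    intros x Hx. apply Hh. eapply ifz_convex with u v; auto. now apply ifz_pos.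
    lra.
  + rewrite (is_RInt_unique _ _ _ _ HI). change (G v - G u <= 2 * M).
    pose proof (HM u Hu) as H1. pose proof (HM v Hv) as H2.
    apply Rabs_le_between in H1. apply Rabs_le_between in H2. lra.
Qed.

(* [h] is split as [(h + g) - g] with both parts nonnegative. *)
Lemma ex_RInt_gen_dominated (h G g : R -> R) (M : R) :
  (forall x, P x -> continuous h x) ->
  (forall x, P x -> is_derive G x (g x)) ->
  (forall x, P x -> continuous g x) ->
  (forall x, P x -> Rabs (h x) <= g x) ->
  (forall x, P x -> Rabs (G x) <= M) ->
  ex_RInt_gen h (at_right 0) Fb.
Proof.
intros Hc HG Hg Hh HM.
assert (Hh' : forall x, P x -> - g x <= h x <= g x /\ 0 <= g x).
{ intros x Hx. generalize (Hh x Hx) (Rabs_pos (h x)). intros H H'.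
  apply Rabs_le_between in H. lra. }
assert (E1 : ex_RInt_gen (fun x => h x + g x) (at_right 0) Fb).
{ apply ex_RInt_gen_dominated_nonneg with (fun x => 2 * G x) (fun x => 2 * g x) (2 * M).
  - intros x Hx. apply (continuous_plus (V := R_NormedModule)); auto.
  - intros x Hx. apply (is_derive_scal G x 2 (g x)); auto.
  - intros x Hx. apply (continuous_scal_r (V := R_NormedModule) 2); auto.
  - intros x Hx. generalize (Hh' x Hx). lra.
  - intros x Hx. rewrite Rabs_mult, Rabs_right by lra.
    generalize (HM x Hx). lra. }
assert (E2 : ex_RInt_gen g (at_right 0) Fb).
{ apply ex_RInt_gen_dominated_nonneg with G g M; auto.
  intros x Hx. generalize (Hh' x Hx). lra. }
destruct E1 as [l1 E1]. destruct E2 as [l2 E2].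
exists (minus l1 l2).
apply RInt_gen_interval_ext with (fun x => minus (h x + g x) (g x)).
- intros x _. change (h x + g x - g x = h x). ring.
- now apply (is_RInt_gen_minus (V := R_NormedModule)).
Qed.

Lemma is_RInt_gen_interval_le (f g : R -> R) (lf lg : R) :
  (forall x, P x -> f x <= g x) ->
  is_RInt_gen f (at_right 0) Fb lf -> is_RInt_gen g (at_right 0) Fb lg -> lf <= lg.
Proof.
intros H Hf Hg.
assert (HD : is_RInt_gen (fun x => minus (g x) (f x)) (at_right 0) Fb (minus lg lf)).
{ now apply (is_RInt_gen_minus (V := R_NormedModule)). }
apply Rnot_lt_le. intros Hlt.
assert (He : 0 < lf - lg) by lra.
assert (HN : filter_prod (at_right 0) Fb (fun _ => False)).
{ generalize (filter_and _ _ (filter_prod_inside _ H)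
    (HD _ (locally_ball (minus lg lf : R) (mkposreal _ He)))).
  apply filter_imp. intros [u v]; simpl. intros [[H1 H2] [y [Hy1 Hy2]]].
  change (Rabs (y - (lg - lf)) < lf - lg) in Hy2.
  apply Rabs_def2 in Hy2.
  assert (0 <= y); [|lra].
  apply (is_RInt_le (fun _ => 0) (fun x => minus (g x) (f x)) u v); auto.
  - pose proof (is_RInt_const (V := R_NormedModule) u v 0) as H0.
    change (scal (v - u) (0:R)) with ((v - u) * 0) in H0. now rewrite Rmult_0_r in H0.
  - intros x Hx. change (0 <= g x - f x). generalize (H2 x). lra. }
apply filter_ex in HN. now destruct HN.
Qed.

Lemma is_RInt_gen_interval_pos (f : R -> R) (l : R) :
  (forall x, P x -> continuous f x) -> (forall x, P x -> 0 < f x) ->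
  is_RInt_gen f (at_right 0) Fb l -> 0 < l.
Proof.
intros Hc Hp Hf.
destruct (ifz_inh (P := P)) as [m Hm].
pose proof (ifz_pos m Hm) as Hm0.
assert (Pm2 : P (m / 2)) by (eapply ifz_convex with (m/2) m; auto; lra).
assert (H0 : 0 < RInt f (m / 2) m).
{ apply RInt_gt_0; try lra.
  - intros x Hx. apply Hp. eapply ifz_convex with (m/2) m; auto; lra.
  - intros x Hx. apply Hc.
    eapply ifz_convex with (m/2) m; auto; lra. }
apply Rlt_le_trans with (1 := H0).
apply Rnot_lt_le. intros Hlt.
assert (He : 0 < RInt f (m / 2) m - l) by lra.
assert (HN : filter_prod (at_right 0) Fb (fun _ => False)).
{ generalize (filter_and _ _ (filter_prod_interval _ _ Pm2 Hm)
    (Hf _ (locally_ball (l : R) (mkposreal _ He)))).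
  apply filter_imp. intros [u v]; simpl. intros [[H1 [H2 H3]] [y [Hy1 Hy2]]].
  change (Rabs (y - l) < RInt f (m/2) m - l) in Hy2.
  apply Rabs_def2 in Hy2.
  assert (Pu : P u) by (eapply ifz_convex with u v; auto; lra).
  assert (RInt f (m/2) m <= y); [|lra].
  rewrite <- (is_RInt_unique _ _ _ _ Hy1).
  rewrite <- (RInt_Chasles (V := R_CompleteNormedModule) f u (m/2) v) by
      (now apply ex_RInt_inside).
  rewrite <- (RInt_Chasles (V := R_CompleteNormedModule) f (m/2) m v) by
      (now apply ex_RInt_inside).
  change plus with Rplus.
  assert (0 <= RInt f u (m/2)).
  { apply RInt_ge_0; try lra. now apply ex_RInt_inside.
    intros x Hx. apply Rlt_le, Hp. eapply ifz_convex with u m; auto; lra. }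
  assert (0 <= RInt f m v).
  { apply RInt_ge_0; try lra. now apply ex_RInt_inside.
    intros x Hx. apply Rlt_le, Hp. eapply ifz_convex with m v; auto; lra. }
  lra. }
apply filter_ex in HN. now destruct HN.
Qed.

Lemma is_RInt_gen_interval_derive (F f : R -> R) (la lb : R) :
  (forall x, P x -> is_derive F x (f x)) -> (forall x, P x -> continuous f x) ->
  filterlim F (at_right 0) (locally la) -> filterlim F Fb (locally lb) ->
  is_RInt_gen f (at_right 0) Fb (lb - la).
Proof.
intros HF Hf Ha Hb Q HQ.
assert (HL : filterlim (fun ab : R * R => F (snd ab) - F (fst ab))
   (filter_prod (at_right 0) Fb) (locally (lb - la))).
{ assert (H1 : filterlim (fun ab : R * R => F (snd ab))
    (filter_prod (at_right 0) Fb) (locally lb)).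
  { eapply filterlim_comp; [apply (filterlim_snd (F := at_right 0))|exact Hb]. }
  assert (H2 : filterlim (fun ab : R * R => - F (fst ab))
    (filter_prod (at_right 0) Fb) (locally (- la))).
  { eapply filterlim_comp;
      [|apply (filterlim_opp (K := R_AbsRing) (V := R_NormedModule))].
    eapply filterlim_comp; [apply (filterlim_fst (G := Fb))|exact Ha]. }
  exact (filterlim_comp_2 _ _ Rplus H1 H2
    (filterlim_plus (K := R_AbsRing) (V := R_NormedModule) lb (- la))). }
specialize (HL Q HQ). unfold filtermap in HL. unfold filtermapi.
generalize (filter_and _ _ HL (filter_prod_inside P (fun x h => h))).
apply filter_imp. intros [u v]; simpl. intros [H1 [H2 H3]].
exists (F v - F u). split; auto.
apply (is_RInt_derive (V := R_CompleteNormedModule)).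
- intros x Hx. apply HF, H3. rewrite Rmin_left, Rmax_right in Hx by lra. lra.
- intros x Hx. apply Hf, H3. rewrite Rmin_left, Rmax_right in Hx by lra. lra.
Qed.

End Improper.

(** * The Gamma function *)

Lemma Rpower_succ (t z : R) : 0 < t -> Rpower t (z + 1) = Rpower t z * t.
Proof. intros Ht. now rewrite Rpower_plus, Rpower_1. Qed.

Lemma Rpower_pred (t z : R) : 0 < t -> Rpower t (z - 1) = Rpower t z / t.
Proof.
intros Ht. replace z with (z - 1 + 1) at 2 by ring.
rewrite Rpower_succ by auto. field. lra.
Qed.

Lemma Rpower_pos (t z : R) : 0 < Rpower t z.
Proof. apply exp_pos. Qed.

Lemma ln_le_tangent (t l : R) : 0 < t -> 0 < l -> ln t <= ln l + (t - l) / l.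
Proof.
intros Ht Hl.
pose proof (exp_ineq1_le (ln (t / l))) as H.
rewrite exp_ln in H by (apply Rdiv_lt_0_compat; lra).
rewrite ln_div in H by lra.
replace ((t - l) / l) with (t / l - 1) by (field; lra). lra.
Qed.

Lemma Rpower_le_tangent (u l s : R) : 0 < u -> 0 < l -> 0 <= s <= 1 ->
  Rpower u s <= Rpower l s * ((1 - s) + s * (u / l)).
Proof.
intros Hu Hl Hs.
assert (Hv : 0 < u / l) by (apply Rdiv_lt_0_compat; lra).
replace (Rpower u s) with (Rpower l s * Rpower (u / l) s).
2: { rewrite Rpower_mult_distr by auto. f_equal. field. lra. }
apply Rmult_le_compat_l; [apply Rlt_le, Rpower_pos|].
generalize dependent (u / l). intros v Hv.
set (w := 1 - s + s * v).
assert (Hw : 0 < w).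
{ unfold w. destruct (Req_dec s 0) as [->|H]; [lra|].
  assert (0 < s * v) by (apply Rmult_lt_0_compat; lra). lra. }
pose proof (ln_le_tangent v w Hv Hw) as H1.
pose proof (ln_le_tangent 1 w Rlt_0_1 Hw) as H2. rewrite ln_1 in H2.
unfold Rpower. rewrite <- (exp_ln w) by auto.
destruct (Rle_lt_or_eq_dec (s * ln v) (ln w)) as [H|H].
- replace (ln w) with (s * (ln w + (v - w) / w) + (1 - s) * (ln w + (1 - w) / w)).
  2: { unfold w. field. fold w. lra. }
  apply Rle_trans with (s * ln v + (1 - s) * 0); [lra|].
  apply Rplus_le_compat; apply Rmult_le_compat_l; lra.
- now apply Rlt_le, exp_increasing.
- rewrite H. lra.
Qed.

Lemma continuous_Rpower (t z : R) : 0 < t -> continuous (fun t => Rpower t z) t.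
Proof.
intros Ht. apply (ex_derive_continuous (V := R_NormedModule)).
unfold Rpower. auto_derive. auto.
Qed.

Lemma filterlim_Rpower_0 (z : R) : 0 < z ->
  filterlim (fun t => Rpower t z) (at_right 0) (locally 0).
Proof.
intros Hz. apply filterlim_locally. intros eps.
assert (Hd : 0 < Rpower eps (/ z)) by apply Rpower_pos.
exists (mkposreal _ Hd). intros y Hy Hy0.
change (Rabs (y - 0) < Rpower eps (/ z)) in Hy. apply Rabs_def2 in Hy.
change (Rabs (Rpower y z - 0) < eps).
rewrite Rminus_0_r, Rabs_right by apply Rgt_ge, Rpower_pos.
replace (pos eps) with (Rpower (Rpower eps (/ z)) z).
2: { rewrite Rpower_mult, Rinv_l, Rpower_1; auto. apply eps. lra. }
apply Rlt_Rpower_l; lra.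
Qed.

Section Lyapunov.
Context {Fb : (R -> Prop) -> Prop} {P : R -> Prop} {HP : interval_from_0 Fb P}.

Lemma moment_interpolation (w m : R -> R) (I0 Is l s : R) : 0 < l -> 0 <= s <= 1 ->
  (forall t, P t -> 0 <= w t) -> (forall t, P t -> 0 < m t) ->
  is_RInt_gen w (at_right 0) Fb I0 ->
  is_RInt_gen (fun t => w t * m t) (at_right 0) Fb (l * I0) ->
  is_RInt_gen (fun t => w t * Rpower (m t) s) (at_right 0) Fb Is ->
  Is <= Rpower l s * I0.
Proof.
intros Hl Hs Hw Hm H0 H1 H2.
replace (Rpower l s * I0) with
  (plus (scal (Rpower l s * (1 - s)) I0) (scal (Rpower l s * s / l) (l * I0))).
2: { unfold plus, scal; simpl; unfold mult; simpl. field. lra. }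
eapply is_RInt_gen_interval_le; [|exact H2|].
2: { apply (is_RInt_gen_plus (V := R_NormedModule));
     apply (is_RInt_gen_scal (V := R_NormedModule)); [exact H0|exact H1]. }
intros t Ht. unfold plus, scal; simpl; unfold mult; simpl.
apply Rle_trans with (w t * (Rpower l s * ((1 - s) + s * (m t / l)))).
- apply Rmult_le_compat_l; auto. apply Rpower_le_tangent; auto.
- right. field. lra.
Qed.
End Lyapunov.

Lemma Rpower_exp_bound (y : R) : 0 <= y ->
  exists K, 0 < K /\ forall t, 0 < t -> Rpower t y * exp (- t) <= K * exp (- t / 2).
Proof.
intros [Hy | <-].
- exists (exp (y * (ln (2 * y) - 1))). split; [apply exp_pos|].
  intros t Ht. unfold Rpower. rewrite <- !exp_plus.
  assert (y * ln t <= y * (ln (2 * y) - 1) + t / 2).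
  { assert (H2y : 0 < 2 * y) by lra.
    pose proof (ln_le_tangent t (2 * y) Ht H2y) as H.
    apply Rmult_le_compat_l with (r := y) in H; [|lra].
    apply Rle_trans with (1 := H). right. field. lra. }
  destruct (Rle_lt_or_eq_dec (y * ln t + - t) (y * (ln (2 * y) - 1) + - t / 2)).
  lra. now apply Rlt_le, exp_increasing. rewrite e; lra.
- exists 1. split; [lra|]. intros t Ht. rewrite Rpower_O by auto.
  rewrite !Rmult_1_l. apply Rlt_le, exp_increasing. lra.
Qed.

Lemma filterlim_Rpower_exp_infty (y : R) : 0 <= y ->
  filterlim (fun t => Rpower t y * exp (- t)) (Rbar_locally p_infty) (locally 0).
Proof.
intros Hy. destruct (Rpower_exp_bound y Hy) as [K [HK H]].
apply filterlim_locally. intros eps.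
exists (Rmax 0 (- 2 * ln (eps / K))). intros t Ht.
assert (Ht0 : 0 < t) by (eapply Rle_lt_trans; [apply Rmax_l|exact Ht]).
assert (Ht1 : - 2 * ln (eps / K) < t) by (eapply Rle_lt_trans; [apply Rmax_r|exact Ht]).
change (Rabs (Rpower t y * exp (- t) - 0) < eps).
rewrite Rminus_0_r, Rabs_right.
2: { apply Rgt_ge, Rmult_lt_0_compat; apply exp_pos. }
apply Rle_lt_trans with (1 := H t Ht0).
assert (He : 0 < eps / K) by (apply Rdiv_lt_0_compat; [apply eps|auto]).
replace (pos eps) with (K * exp (ln (eps / K))) by (rewrite exp_ln by auto; field; lra).
apply Rmult_lt_compat_l; auto. apply exp_increasing. lra.
Qed.

Lemma continuous_Gamma_integrand (x t : R) : 0 < t ->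
  continuous (fun t => Rpower t (x - 1) * exp (- t)) t.
Proof.
intros Ht. apply (ex_derive_continuous (V := R_NormedModule)).
unfold Rpower. auto_derive. auto.
Qed.

Lemma is_RInt_gen_Gamma (x : R) : 0 < x ->
  is_RInt_gen (fun t => Rpower t (x - 1) * exp (- t))
    (at_right 0) (Rbar_locally p_infty) (Gamma x).
Proof.
intros Hx. apply (RInt_gen_correct (V := R_CompleteNormedModule)).
destruct (Rpower_exp_bound x) as [K [HK H]]; [lra|].
set (G := fun t => (Rpower t x * exp (- t) - 2 * K * exp (- t / 2)) / x).
apply (ex_RInt_gen_dominated_nonneg (P := fun t => 0 < t)) with (G := G) (M := 3 * K / x)
  (g := fun t => (x * Rpower t (x - 1) * exp (- t)
     + (K * exp (- t / 2) - Rpower t x * exp (- t))) / x).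
- intros t Ht. now apply continuous_Gamma_integrand.
- intros t Ht. unfold G.
  rewrite Rpower_pred by auto. unfold Rpower.
  auto_derive; [auto|]. unfold Rdiv. field. lra.
- intros t Ht. apply (ex_derive_continuous (V := R_NormedModule)).
  unfold Rpower. auto_derive. auto.
- intros t Ht. split.
  + apply Rlt_le, Rmult_lt_0_compat; apply exp_pos.
  + generalize (H t Ht). generalize (exp (- t / 2)). intros e He.
    apply Rmult_le_reg_r with x; auto. unfold Rdiv.
    rewrite (Rmult_assoc _ (/ x)), Rinv_l, Rmult_1_r by lra. lra.
- intros t Ht. unfold G, Rdiv. rewrite Rabs_mult, (Rabs_right (/ x)).
  2: { apply Rgt_ge, Rinv_0_lt_compat; auto. }
  apply Rmult_le_compat_r; [apply Rlt_le, Rinv_0_lt_compat; auto|].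
  assert (H1 : 0 < Rpower t x * exp (- t)) by (apply Rmult_lt_0_compat; apply exp_pos).
  assert (H2 : 0 < exp (- t / 2) < 1).
  { split; [apply exp_pos|]. rewrite <- exp_0. apply exp_increasing. lra. }
  assert (H3 : K * exp (- t / 2) <= K * 1) by (apply Rmult_le_compat_l; lra).
  assert (H4 : 0 < K * exp (- t / 2)) by (apply Rmult_lt_0_compat; lra).
  generalize (H t Ht). intros H5. apply Rabs_le. unfold Rdiv in *. lra.
Qed.

Lemma Gamma_pos (x : R) : 0 < x -> 0 < Gamma x.
Proof.
intros Hx. eapply (is_RInt_gen_interval_pos (P := fun t => 0 < t)).
3: now apply is_RInt_gen_Gamma.
- intros t Ht. now apply continuous_Gamma_integrand.
- intros t Ht. apply Rmult_lt_0_compat; apply exp_pos.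
Qed.

Lemma Gamma_succ (x : R) : 0 < x -> Gamma (x + 1) = x * Gamma x.
Proof.
intros Hx.
assert (H : is_RInt_gen (fun t => x * Rpower t (x - 1) * exp (- t) - Rpower t x * exp (- t))
  (at_right 0) (Rbar_locally p_infty) (0 - 0)).
{ apply (is_RInt_gen_interval_derive (P := fun t => 0 < t))
    with (F := fun t => Rpower t x * exp (- t)).
  - intros t Ht. rewrite Rpower_pred by auto. unfold Rpower.
    auto_derive; [auto|]. field. lra.
  - intros t Ht. apply (ex_derive_continuous (V := R_NormedModule)).
    unfold Rpower. auto_derive. auto.
  - apply filterlim_locally. intros eps.
    generalize (proj1 (filterlim_locally _ _) (filterlim_Rpower_0 x Hx) eps).
    intros [d Hd]. exists d. intros t Ht Ht0. generalize (Hd t Ht Ht0).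
    change (Rabs (Rpower t x - 0) < eps -> Rabs (Rpower t x * exp (- t) - 0) < eps).
    rewrite !Rminus_0_r, Rabs_mult. intros H. apply Rle_lt_trans with (2 := H).
    rewrite (Rabs_right (exp _)) by apply Rgt_ge, exp_pos.
    rewrite <- (Rmult_1_r (Rabs (Rpower t x))) at 2.
    apply Rmult_le_compat_l; [apply Rabs_pos|].
    rewrite <- exp_0. apply Rlt_le, exp_increasing. lra.
  - apply filterlim_Rpower_exp_infty. lra. }
assert (H1 : 0 < x + 1) by lra.
pose proof (is_RInt_gen_Gamma _ H1) as HG1.
pose proof (is_RInt_gen_scal (V := R_NormedModule) _ x _ (is_RInt_gen_Gamma _ Hx)) as HG.
pose proof (is_RInt_gen_minus (V := R_NormedModule) _ _ _ _ HG HG1) as HM.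
assert (E : minus (scal x (Gamma x)) (Gamma (x + 1)) = (0 - 0 : R)).
{ refine (eq_trans (eq_sym (is_RInt_gen_unique (V := R_CompleteNormedModule) _ _ HM)) _).
  apply (is_RInt_gen_unique (V := R_CompleteNormedModule)).
  eapply (RInt_gen_interval_ext (P := fun t => 0 < t)); [|exact H].
  intros t Ht. unfold minus, plus, opp, scal; simpl; unfold mult; simpl.
  replace (x + 1 - 1) with x by ring. ring. }
change (x * Gamma x - Gamma (x + 1) = 0 - 0) in E. lra.
Qed.

Lemma Gamma_add_le (x s : R) : 0 < x -> 0 <= s <= 1 ->
  Gamma (x + s) <= Rpower x s * Gamma x.
Proof.
intros Hx Hs.
apply (moment_interpolation (P := fun t => 0 < t) (fun t => Rpower t (x - 1) * exp (- t))
  (fun t => t)); auto.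
- intros t Ht. apply Rlt_le, Rmult_lt_0_compat; apply exp_pos.
- now apply is_RInt_gen_Gamma.
- rewrite <- Gamma_succ by auto. assert (H1 : 0 < x + 1) by lra.
  eapply (RInt_gen_interval_ext (P := fun t => 0 < t)); [|apply is_RInt_gen_Gamma; auto].
  intros t Ht. simpl. replace (x + 1 - 1) with (x - 1 + 1) by ring.
  rewrite Rpower_succ by auto. ring.
- assert (H1 : 0 < x + s) by lra.
  eapply (RInt_gen_interval_ext (P := fun t => 0 < t)); [|apply is_RInt_gen_Gamma; auto].
  intros t Ht. simpl. replace (x + s - 1) with (x - 1 + s) by ring.
  rewrite Rpower_plus by auto. ring.
Qed.

(** * Beta integrals *)

Definition beta_weight (x y t : R) : R := Rpower t (x - 1) * Rpower (1 - t) (y - 1).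

Definition beta_int (x y : R) (phi : R -> R) : R :=
  RInt_gen (fun t => beta_weight x y t * phi t) (at_right 0) (at_left 1).

Definition bounded_continuous (phi : R -> R) : Prop :=
  (forall t, 0 < t < 1 -> continuous phi t) /\
  exists M, forall t, 0 < t < 1 -> Rabs (phi t) <= M.

Lemma bounded_continuous_const (k : R) : bounded_continuous (fun _ => k).
Proof.
split; [intros; apply continuous_const|]. exists (Rabs k). intros; lra.
Qed.

Lemma bounded_continuous_id : bounded_continuous (fun t => t).
Proof.
split; [intros; apply continuous_id|]. exists 1.
intros t Ht; rewrite Rabs_right; lra.
Qed.

Lemma bounded_continuous_plus (f g : R -> R) :
  bounded_continuous f -> bounded_continuous g ->
  bounded_continuous (fun t => f t + g t).
Proof.
intros [Hf [M HM]] [Hg [N HN]]. split.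
- intros t Ht. apply (continuous_plus (V := R_NormedModule)); auto.
- exists (M + N). intros t Ht. apply Rle_trans with (1 := Rabs_triang _ _).
  apply Rplus_le_compat; auto.
Qed.

Lemma bounded_continuous_mult (f g : R -> R) :
  bounded_continuous f -> bounded_continuous g ->
  bounded_continuous (fun t => f t * g t).
Proof.
intros [Hf [M HM]] [Hg [N HN]]. split.
- intros t Ht. apply (continuous_mult (K := R_AbsRing)); auto.
- exists (M * N). intros t Ht. rewrite Rabs_mult.
  apply Rmult_le_compat; auto; apply Rabs_pos.
Qed.

Lemma bounded_continuous_scal (k : R) (f : R -> R) :
  bounded_continuous f -> bounded_continuous (fun t => k * f t).
Proof.
intros Hf. apply (bounded_continuous_mult (fun _ => k)); auto.
apply bounded_continuous_const.
Qed.

Lemma bounded_continuous_pow (f : R -> R) (n : nat) :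
  bounded_continuous f -> bounded_continuous (fun t => f t ^ n).
Proof.
intros Hf. induction n as [|n IH].
- apply (bounded_continuous_const 1).
- now apply (bounded_continuous_mult f).
Qed.

Lemma bounded_continuous_sum_n (f : nat -> R -> R) (n : nat) :
  (forall k, bounded_continuous (f k)) ->
  bounded_continuous (fun t => sum_n (fun k => f k t) n).
Proof.
intros Hf. induction n as [|n [IH1 [M IH2]]].
- destruct (Hf 0%nat) as [H1 [M H2]]. split.
  + intros t Ht. apply continuous_ext with (f 0%nat); auto.
    intros u. now rewrite sum_O.
  + exists M. intros t Ht. rewrite sum_O. auto.
- destruct (bounded_continuous_plus _ _ (conj IH1 (ex_intro _ M IH2)) (Hf (S n)))
    as [H1 [N H2]]. split.
  + intros t Ht. eapply continuous_ext; [|apply H1; auto].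
    intros u. now rewrite sum_Sn.
  + exists N. intros t Ht. rewrite sum_Sn. now apply H2.
Qed.

Lemma continuous_beta_weight (x y t : R) : 0 < t < 1 ->
  continuous (beta_weight x y) t.
Proof.
intros Ht. apply (ex_derive_continuous (V := R_NormedModule)).
unfold beta_weight, Rpower. auto_derive. split; [|split]; auto; lra.
Qed.

Lemma beta_weight_pos (x y t : R) : 0 < beta_weight x y t.
Proof. apply Rmult_lt_0_compat; apply exp_pos. Qed.

Lemma Rpower_le_2 (t z : R) : / 2 <= t < 1 -> -1 <= z -> Rpower t z <= 2.
Proof.
intros Ht Hz. rewrite <- (exp_ln 2) by lra. unfold Rpower.
assert (H1 : ln t <= 0).
{ rewrite <- ln_1. apply Rlt_le, ln_increasing; lra. }
assert (H2 : - ln 2 <= ln t).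
{ rewrite <- ln_Rinv by lra. destruct (proj1 Ht) as [H|<-]; [|lra].
  apply Rlt_le, ln_increasing; lra. }
assert (z * ln t <= ln 2).
{ assert (0 <= (z + 1) * - ln t) by (apply Rmult_le_pos; lra). lra. }
destruct H as [H| ->]; [|lra]. apply Rlt_le, exp_increasing. lra.
Qed.

Lemma beta_weight_bound (x y t : R) : 0 < x -> 0 < y -> 0 < t < 1 ->
  beta_weight x y t <= 2 * Rpower t (x - 1) + 2 * Rpower (1 - t) (y - 1).
Proof.
intros Hx Hy Ht. unfold beta_weight.
pose proof (Rpower_pos t (x - 1)). pose proof (Rpower_pos (1 - t) (y - 1)).
destruct (Rle_dec (/ 2) t) as [H2|H2].
- assert (Rpower t (x - 1) <= 2) by (apply Rpower_le_2; lra).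
  assert (Rpower t (x - 1) * Rpower (1 - t) (y - 1) <= 2 * Rpower (1 - t) (y - 1));
    [apply Rmult_le_compat_r|]; lra.
- assert (Rpower (1 - t) (y - 1) <= 2) by (apply Rpower_le_2; lra).
  assert (Rpower t (x - 1) * Rpower (1 - t) (y - 1) <= Rpower t (x - 1) * 2);
    [apply Rmult_le_compat_l|]; lra.
Qed.

Lemma Rpower_le_1 (t z : R) : 0 < t < 1 -> 0 <= z -> Rpower t z <= 1.
Proof.
intros Ht Hz. rewrite <- exp_0. unfold Rpower.
assert (H1 : ln t <= 0).
{ rewrite <- ln_1. apply Rlt_le, ln_increasing; lra. }
assert (z * ln t <= 0).
{ replace 0 with (z * 0) by ring. apply Rmult_le_compat_l; lra. }
destruct H as [H| ->]; [|lra]. now apply Rlt_le, exp_increasing.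
Qed.

Lemma bounded_continuous_Rpower_1m (z : R) : 0 <= z ->
  bounded_continuous (fun t => Rpower (1 - t) z).
Proof.
intros Hz. split.
- intros t Ht. apply (ex_derive_continuous (V := R_NormedModule)).
  unfold Rpower. auto_derive. lra.
- exists 1. intros t Ht. rewrite Rabs_right by apply Rgt_ge, Rpower_pos.
  apply Rpower_le_1; lra.
Qed.

Section Beta.
Variables x y : R.
Hypotheses (Hx : 0 < x) (Hy : 0 < y).

Lemma is_RInt_gen_beta (phi : R -> R) : bounded_continuous phi ->
  is_RInt_gen (fun t => beta_weight x y t * phi t) (at_right 0) (at_left 1)
    (beta_int x y phi).
Proof.
intros [Hc [M HM]].
assert (HM0 : 0 <= M).
{ apply Rle_trans with (Rabs (phi (/2))). apply Rabs_pos. apply HM; lra. }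
apply (RInt_gen_correct (V := R_CompleteNormedModule)).
apply (ex_RInt_gen_dominated (P := fun t => 0 < t < 1)) with
  (G := fun t => M * (2 * Rpower t x / x - 2 * Rpower (1 - t) y / y))
  (g := fun t => M * (2 * Rpower t (x - 1) + 2 * Rpower (1 - t) (y - 1)))
  (M := M * (2 / x + 2 / y)).
- intros t Ht. apply (continuous_mult (K := R_AbsRing)); auto.
  now apply continuous_beta_weight.
- intros t Ht. rewrite !Rpower_pred by lra. unfold Rpower.
  auto_derive; [repeat split; lra|].
  replace (1 + - t) with (1 - t) by ring. field. lra.
- intros t Ht. apply (ex_derive_continuous (V := R_NormedModule)).
  unfold Rpower. auto_derive. lra.
- intros t Ht. rewrite Rabs_mult, Rabs_right by apply Rgt_ge, beta_weight_pos.
  rewrite Rmult_comm. apply Rmult_le_compat; auto.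
  + apply Rabs_pos.
  + apply Rlt_le, beta_weight_pos.
  + now apply beta_weight_bound.
- intros t Ht. rewrite Rabs_mult, (Rabs_right M) by lra.
  apply Rmult_le_compat_l; auto.
  assert (H1 : 0 <= 2 * Rpower t x / x <= 2 / x).
  { pose proof (Rpower_pos t x). assert (Rpower t x <= 1) by (apply Rpower_le_1; lra).
    pose proof (Rinv_0_lt_compat x Hx).
    split; [apply Rmult_le_pos|apply Rmult_le_compat_r]; lra. }
  assert (H2 : 0 <= 2 * Rpower (1 - t) y / y <= 2 / y).
  { pose proof (Rpower_pos (1 - t) y).
    assert (Rpower (1 - t) y <= 1) by (apply Rpower_le_1; lra).
    pose proof (Rinv_0_lt_compat y Hy).
    split; [apply Rmult_le_pos|apply Rmult_le_compat_r]; lra. }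
  apply Rabs_le; lra.
Qed.

Lemma beta_int_unique (phi : R -> R) (l : R) :
  is_RInt_gen (fun t => beta_weight x y t * phi t) (at_right 0) (at_left 1) l ->
  beta_int x y phi = l.
Proof. apply (is_RInt_gen_unique (V := R_CompleteNormedModule)). Qed.

Lemma beta_int_ext (f g : R -> R) : bounded_continuous f ->
  (forall t, 0 < t < 1 -> f t = g t) -> beta_int x y f = beta_int x y g.
Proof.
intros Hf H. symmetry. apply beta_int_unique.
eapply (RInt_gen_interval_ext (P := fun t => 0 < t < 1)); [|now apply is_RInt_gen_beta].
intros t Ht. simpl. now rewrite H.
Qed.

Lemma beta_int_plus (f g : R -> R) : bounded_continuous f -> bounded_continuous g ->
  beta_int x y (fun t => f t + g t) = beta_int x y f + beta_int x y g.
Proof.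
intros Hf Hg. apply beta_int_unique.
eapply (RInt_gen_interval_ext (P := fun t => 0 < t < 1)).
2: apply (is_RInt_gen_plus (V := R_NormedModule)); now apply is_RInt_gen_beta.
intros t Ht. unfold plus; simpl. ring.
Qed.

Lemma beta_int_scal (k : R) (f : R -> R) : bounded_continuous f ->
  beta_int x y (fun t => k * f t) = k * beta_int x y f.
Proof.
intros Hf. apply beta_int_unique.
eapply (RInt_gen_interval_ext (P := fun t => 0 < t < 1)).
2: apply (is_RInt_gen_scal (V := R_NormedModule)) with (k := k); now apply is_RInt_gen_beta.
intros t Ht. unfold scal; simpl; unfold mult; simpl. ring.
Qed.

Lemma beta_int_le (f g : R -> R) : bounded_continuous f -> bounded_continuous g ->
  (forall t, 0 < t < 1 -> f t <= g t) -> beta_int x y f <= beta_int x y g.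
Proof.
intros Hf Hg H.
eapply (is_RInt_gen_interval_le (P := fun t => 0 < t < 1)); try now apply is_RInt_gen_beta.
intros t Ht. simpl. apply Rmult_le_compat_l; auto. apply Rlt_le, beta_weight_pos.
Qed.

Lemma beta_int_1_pos : 0 < beta_int x y (fun _ => 1).
Proof.
eapply (is_RInt_gen_interval_pos (P := fun t => 0 < t < 1)).
3: apply is_RInt_gen_beta, bounded_continuous_const.
- intros t Ht. apply (continuous_mult (K := R_AbsRing)).
  now apply continuous_beta_weight. apply continuous_const.
- intros t Ht. simpl. rewrite Rmult_1_r. apply beta_weight_pos.
Qed.
End Beta.

Lemma beta_int_succ_l (x y : R) (phi : R -> R) : 0 < x -> 0 < y ->
  bounded_continuous phi ->
  beta_int (x + 1) y phi = beta_int x y (fun t => t * phi t).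
Proof.
intros Hx Hy Hp. apply beta_int_unique.
eapply (RInt_gen_interval_ext (P := fun t => 0 < t < 1)).
2: { apply is_RInt_gen_beta; auto.
     now apply (bounded_continuous_mult (fun t => t)), Hp; apply bounded_continuous_id. }
intros t Ht. unfold beta_weight. replace (x + 1 - 1) with (x - 1 + 1) by ring.
rewrite Rpower_succ by lra. ring.
Qed.

Lemma beta_int_add_r (x y z : R) (phi : R -> R) : 0 < x -> 0 < y -> 0 <= z ->
  bounded_continuous phi ->
  beta_int x (y + z) phi = beta_int x y (fun t => Rpower (1 - t) z * phi t).
Proof.
intros Hx Hy Hz Hp. apply beta_int_unique.
eapply (RInt_gen_interval_ext (P := fun t => 0 < t < 1)).
2: { apply is_RInt_gen_beta; auto.
     now apply (bounded_continuous_mult (fun t => Rpower (1 - t) z)), Hp;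
       apply bounded_continuous_Rpower_1m. }
intros t Ht. unfold beta_weight. replace (y + z - 1) with (y - 1 + z) by ring.
rewrite Rpower_plus by lra. ring.
Qed.

Definition Beta (x y : R) : R := beta_int x y (fun _ => 1).

Lemma Beta_pos (x y : R) : 0 < x -> 0 < y -> 0 < Beta x y.
Proof. apply beta_int_1_pos. Qed.

Lemma Beta_by_parts (x y : R) : 0 < x -> 0 < y ->
  x * Beta x (y + 1) = y * Beta (x + 1) y.
Proof.
intros Hx Hy.
assert (H : is_RInt_gen (fun t => x * (beta_weight x (y + 1) t * 1)
     - y * (beta_weight (x + 1) y t * 1))
  (at_right 0) (at_left 1) (0 - 0)).
{ apply (is_RInt_gen_interval_derive (P := fun t => 0 < t < 1))
    with (F := fun t => Rpower t x * Rpower (1 - t) y).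
  - intros t Ht. unfold beta_weight.
    replace (x + 1 - 1) with x by ring. replace (y + 1 - 1) with y by ring.
    rewrite !Rpower_pred by lra. unfold Rpower.
    auto_derive; [repeat split; lra|].
    replace (1 + - t) with (1 - t) by ring. field. lra.
  - intros t Ht. apply (ex_derive_continuous (V := R_NormedModule)).
    unfold beta_weight, Rpower. auto_derive. repeat split; lra.
  - apply filterlim_locally. intros eps.
    generalize (proj1 (filterlim_locally _ _) (filterlim_Rpower_0 x Hx) eps).
    intros HF. assert (H1 : at_right 0 (fun t => t < 1)).
    { exists (mkposreal 1 Rlt_0_1). intros t Ht _.
      change (Rabs (t - 0) < 1) in Ht. apply Rabs_def2 in Ht. lra. }
    generalize (filter_and _ _ HF H1). intros [d Hd]. exists d.
    intros t Ht Ht0. generalize (Hd t Ht Ht0).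
    change (Rabs (Rpower t x - 0) < eps /\ t < 1 ->
      Rabs (Rpower t x * Rpower (1 - t) y - 0) < eps).
    rewrite !Rminus_0_r, Rabs_mult. intros [H Ht1]. apply Rle_lt_trans with (2 := H).
    rewrite (Rabs_right (Rpower (1 - t) y)) by apply Rgt_ge, exp_pos.
    rewrite <- (Rmult_1_r (Rabs (Rpower t x))) at 2.
    apply Rmult_le_compat_l; [apply Rabs_pos|]. apply Rpower_le_1; lra.
  - apply filterlim_locally. intros eps.
    generalize (proj1 (filterlim_locally _ _) (filterlim_Rpower_0 y Hy) eps).
    intros [d Hd]. assert (Hm : 0 < Rmin d 1) by (apply Rmin_pos; [apply d|lra]).
    exists (mkposreal _ Hm). intros t Ht Ht1.
    change (Rabs (t - 1) < Rmin d 1) in Ht.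
    assert (Hd1 : Rabs (t - 1) < d) by (eapply Rlt_le_trans; [exact Ht|apply Rmin_l]).
    assert (Hd2 : Rabs (t - 1) < 1) by (eapply Rlt_le_trans; [exact Ht|apply Rmin_r]).
    apply Rabs_def2 in Hd2.
    assert (Hb : ball 0 d (1 - t)).
    { change (Rabs (1 - t - 0) < d). now rewrite Rminus_0_r, Rabs_minus_sym. }
    assert (H1t : 0 < 1 - t) by lra.
    generalize (Hd _ Hb H1t).
    change (Rabs (Rpower (1 - t) y - 0) < eps ->
      Rabs (Rpower t x * Rpower (1 - t) y - 0) < eps).
    rewrite !Rminus_0_r, Rabs_mult. intros H. apply Rle_lt_trans with (2 := H).
    rewrite (Rabs_right (Rpower t x)) by apply Rgt_ge, exp_pos.
    rewrite <- (Rmult_1_l (Rabs (Rpower (1 - t) y))) at 2.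
    apply Rmult_le_compat_r; [apply Rabs_pos|]. apply Rpower_le_1; lra. }
assert (H1 := is_RInt_gen_beta x (y + 1) Hx ltac:(lra) _ (bounded_continuous_const 1)).
assert (H2 := is_RInt_gen_beta (x + 1) y ltac:(lra) Hy _ (bounded_continuous_const 1)).
pose proof (is_RInt_gen_scal (V := R_NormedModule) _ x _ H1) as H1'.
pose proof (is_RInt_gen_scal (V := R_NormedModule) _ y _ H2) as H2'.
pose proof (is_RInt_gen_minus (V := R_NormedModule) _ _ _ _ H1' H2') as HM.
pose proof (is_RInt_gen_unique (V := R_CompleteNormedModule) _ _ HM) as E1.
pose proof (is_RInt_gen_unique (V := R_CompleteNormedModule) _ _ H) as E2.
assert (E : x * Beta x (y + 1) - y * Beta (x + 1) y = 0 - 0)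
  by exact (eq_trans (eq_sym E1) E2).
lra.
Qed.

Lemma Beta_add (x y : R) : 0 < x -> 0 < y ->
  Beta x (y + 1) + Beta (x + 1) y = Beta x y.
Proof.
intros Hx Hy. unfold Beta.
rewrite beta_int_add_r, beta_int_succ_l by (auto using bounded_continuous_const; lra).
rewrite <- beta_int_plus; auto.
- symmetry. apply beta_int_ext; auto using bounded_continuous_const.
  intros t Ht. rewrite Rpower_1 by lra. ring.
- apply (bounded_continuous_mult (fun t => Rpower (1 - t) 1));
  [apply bounded_continuous_Rpower_1m; lra|apply bounded_continuous_const].
- apply (bounded_continuous_mult (fun t => t));
  [apply bounded_continuous_id|apply bounded_continuous_const].
Qed.

Lemma Beta_succ_l (x y : R) : 0 < x -> 0 < y -> Beta (x + 1) y = x / (x + y) * Beta x y.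
Proof.
intros Hx Hy. pose proof (Beta_by_parts x y Hx Hy) as H1.
pose proof (Beta_add x y Hx Hy) as H2.
apply Rmult_eq_reg_l with (x + y); [|lra].
transitivity (x * Beta x y); [|field; lra].
rewrite <- H2. rewrite Rmult_plus_distr_r, <- H1. ring.
Qed.

Lemma Beta_succ_r (x y : R) : 0 < x -> 0 < y -> Beta x (y + 1) = y / (x + y) * Beta x y.
Proof.
intros Hx Hy. pose proof (Beta_succ_l x y Hx Hy) as H1.
pose proof (Beta_add x y Hx Hy) as H2. rewrite H1 in H2.
apply Rplus_eq_reg_r with (x / (x + y) * Beta x y). rewrite H2. field. lra.
Qed.

Lemma Beta_add_le (x y s : R) : 0 < x -> 0 < y -> 0 <= s <= 1 ->
  Beta x (y + s) <= Rpower (y / (x + y)) s * Beta x y.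
Proof.
intros Hx Hy Hs.
assert (Hl : 0 < y / (x + y)) by (apply Rdiv_lt_0_compat; lra).
apply (moment_interpolation (P := fun t => 0 < t < 1)
  (fun t => beta_weight x y t * 1) (fun t => 1 - t)); auto.
- intros t Ht. rewrite Rmult_1_r. apply Rlt_le, beta_weight_pos.
- intros t Ht. lra.
- now apply is_RInt_gen_beta, bounded_continuous_const.
- rewrite <- Beta_succ_r by auto.
  apply (RInt_gen_interval_ext (P := fun t => 0 < t < 1))
    with (f := fun t => beta_weight x (y + 1) t * 1);
    [|apply (is_RInt_gen_beta x (y + 1)); [|lra|apply bounded_continuous_const]; auto].
  intros t Ht. unfold beta_weight. simpl.
  replace (y + 1 - 1) with (y - 1 + 1) by ring.
  rewrite (Rpower_succ (1 - t)) by lra. ring.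
- apply (RInt_gen_interval_ext (P := fun t => 0 < t < 1))
    with (f := fun t => beta_weight x (y + s) t * 1);
    [|apply (is_RInt_gen_beta x (y + s)); [|lra|apply bounded_continuous_const]; auto].
  intros t Ht. unfold beta_weight. simpl.
  replace (y + s - 1) with (y - 1 + s) by ring.
  rewrite (Rpower_plus _ _ (1 - t)). ring.
Qed.

Definition beta_gamma_quotient (x y : R) : R := Beta x y * Gamma (x + y) / Gamma y.

Lemma beta_gamma_quotient_add_le (x y s : R) : 0 < x -> 0 < y -> 0 <= s <= 1 ->
  beta_gamma_quotient x (y + s) <= beta_gamma_quotient x y * (1 + / y).
Proof.
intros Hx Hy Hs. unfold beta_gamma_quotient.
pose proof (Beta_add_le x y s Hx Hy Hs) as H1.
pose proof (Gamma_add_le (x + y) s ltac:(lra) Hs) as H2.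
pose proof (Gamma_add_le (y + s) (1 - s) ltac:(lra) ltac:(lra)) as H3.
replace (y + s + (1 - s)) with (y + 1) in H3 by ring.
rewrite Gamma_succ in H3 by auto.
pose proof (Gamma_pos y Hy) as G1. pose proof (Gamma_pos (y + s) ltac:(lra)) as G2.
pose proof (Gamma_pos (x + y) ltac:(lra)) as G3.
pose proof (Gamma_pos (x + (y + s)) ltac:(lra)) as G4.
pose proof (Beta_pos x y Hx Hy) as B1. pose proof (Beta_pos x (y + s) Hx ltac:(lra)) as B2.
apply Rmult_le_reg_r with (Gamma (y + s)); auto.
unfold Rdiv at 1. rewrite Rmult_assoc, Rinv_l, Rmult_1_r by lra.
apply Rle_trans with
  (Rpower (y / (x + y)) s * Beta x y * (Rpower (x + y) s * Gamma (x + y))).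
{ apply Rmult_le_compat; auto; try lra. now rewrite <- Rplus_assoc. }
replace (Rpower (y / (x + y)) s * Beta x y * (Rpower (x + y) s * Gamma (x + y)))
  with (Rpower y s * (Beta x y * Gamma (x + y))).
2: { replace y with (y / (x + y) * (x + y)) at 1 by (field; lra).
     rewrite <- Rpower_mult_distr by (try lra; apply Rdiv_lt_0_compat; lra). ring. }
assert (H4 : Rpower (y + s) (1 - s) * Rpower y s <= 1 + y).
{ apply Rle_trans with (Rpower (1 + y) (1 - s) * Rpower (1 + y) s).
  - apply Rmult_le_compat; try (apply Rlt_le, Rpower_pos); apply Rle_Rpower_l; lra.
  - rewrite <- Rpower_plus. replace (1 - s + s) with 1 by ring.
    rewrite Rpower_1; lra. }
apply Rle_trans with (Beta x y * Gamma (x + y) *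
   (Rpower y s * (Rpower (y + s) (1 - s) * Gamma (y + s)) / (y * Gamma y))).
- rewrite (Rmult_comm (Rpower y s)). apply Rmult_le_compat_l.
  + apply Rlt_le, Rmult_lt_0_compat; auto.
  + apply Rmult_le_reg_r with (y * Gamma y). apply Rmult_lt_0_compat; auto.
    unfold Rdiv. rewrite (Rmult_assoc _ (/ (y * Gamma y))), Rinv_l, Rmult_1_r.
    2: { apply Rgt_not_eq, Rmult_lt_0_compat; auto. }
    apply Rmult_le_compat_l; auto. apply Rlt_le, Rpower_pos.
- replace (Beta x y * Gamma (x + y) / Gamma y * (1 + / y) * Gamma (y + s)) with
    (Beta x y * Gamma (x + y) * ((1 + y) * (Gamma (y + s) / (y * Gamma y)))) by
    (field; lra).
  apply Rmult_le_compat_l; [apply Rlt_le, Rmult_lt_0_compat; auto|].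
  replace (Rpower y s * (Rpower (y + s) (1 - s) * Gamma (y + s)) / (y * Gamma y)) with
   (Rpower (y + s) (1 - s) * Rpower y s * (Gamma (y + s) / (y * Gamma y))) by (field; lra).
  apply Rmult_le_compat_r; auto.
  apply Rlt_le, Rdiv_lt_0_compat; auto. apply Rmult_lt_0_compat; auto.
Qed.

Lemma beta_gamma_quotient_add_nat (x y : R) (n : nat) : 0 < x -> 0 < y ->
  beta_gamma_quotient x (y + INR n) = beta_gamma_quotient x y.
Proof.
intros Hx Hy. induction n as [|n IH].
- simpl. now rewrite Rplus_0_r.
- rewrite <- IH, S_INR. pose proof (pos_INR n) as Hn.
  rewrite <- (Rplus_assoc y). set (z := y + INR n). assert (Hz : 0 < z) by (unfold z; lra).
  unfold beta_gamma_quotient. rewrite Beta_succ_r, <- (Rplus_assoc x), !Gamma_succ by lra.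
  pose proof (Gamma_pos z Hz). field. lra.
Qed.

(* By 1-periodicity the bound [1 + /y] improves to [1 + /(y + n)] for all [n]. *)
Lemma beta_gamma_quotient_add_unit (x y s : R) : 0 < x -> 0 < y -> 0 <= s <= 1 ->
  beta_gamma_quotient x (y + s) <= beta_gamma_quotient x y.
Proof.
intros Hx Hy Hs.
assert (HL : is_lim_seq (fun n => beta_gamma_quotient x y * (1 + / (y + INR n)))
  (beta_gamma_quotient x y * (1 + 0))).
{ apply (is_lim_seq_scal_l _ (beta_gamma_quotient x y) (1 + 0)).
  apply is_lim_seq_plus'; [apply is_lim_seq_const|].
  replace (Finite 0) with (Rbar_inv p_infty) by reflexivity.
  apply is_lim_seq_inv; [|discriminate].
  apply is_lim_seq_plus with (l1 := y) (l2 := p_infty);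
    [apply is_lim_seq_const|apply is_lim_seq_INR|reflexivity]. }
replace (beta_gamma_quotient x y) with (beta_gamma_quotient x y * (1 + 0)) by ring.
apply (is_lim_seq_le (fun _ => beta_gamma_quotient x (y + s)) _
  (beta_gamma_quotient x (y + s)) _) with (2 := is_lim_seq_const _) (3 := HL).
intros n. pose proof (pos_INR n).
rewrite <- (beta_gamma_quotient_add_nat x (y + s) n), <- (beta_gamma_quotient_add_nat x y n)
  by lra.
replace (y + s + INR n) with (y + INR n + s) by ring.
apply beta_gamma_quotient_add_le; lra.
Qed.

Lemma beta_gamma_quotient_const (x y z : R) : 0 < x -> 0 < y -> 0 <= z ->
  beta_gamma_quotient x (y + z) = beta_gamma_quotient x y.
Proof.
intros Hx Hy Hz. destruct (nfloor_ex z Hz) as [n [Hn1 Hn2]].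
replace (y + z) with (y + (z - INR n) + INR n) by ring.
rewrite beta_gamma_quotient_add_nat by lra.
apply Rle_antisym; [apply beta_gamma_quotient_add_unit; lra|].
rewrite <- (beta_gamma_quotient_add_nat x y 1) by lra. simpl INR.
replace (y + 1) with (y + (z - INR n) + (1 - (z - INR n))) by ring.
apply beta_gamma_quotient_add_unit; lra.
Qed.

Lemma Beta_ratio (x y z : R) : 0 < x -> 0 < y -> 0 <= z ->
  Beta x (y + z) / Beta x y =
  Gamma (y + z) * Gamma (x + y) / (Gamma y * Gamma (x + (y + z))).
Proof.
intros Hx Hy Hz. pose proof (beta_gamma_quotient_const x y z Hx Hy Hz) as H.
unfold beta_gamma_quotient in H.
pose proof (Gamma_pos y Hy) as G1. pose proof (Gamma_pos (y + z) ltac:(lra)) as G2.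
pose proof (Gamma_pos (x + (y + z)) ltac:(lra)) as G4.
pose proof (Beta_pos x y Hx Hy) as B1.
replace (Beta x (y + z)) with
 (Beta x (y + z) * Gamma (x + (y + z)) / Gamma (y + z) * (Gamma (y + z) / Gamma (x + (y + z))))
 by (field; lra).
rewrite H. field. lra.
Qed.

(** * The binomial series and means with respect to the beta distribution *)

Lemma pochR_pos (x : R) (n : nat) : 0 < x -> 0 < pochR x n.
Proof.
intros Hx. induction n as [|n IH]; simpl; [lra|].
apply Rmult_lt_0_compat; auto. pose proof (pos_INR n). lra.
Qed.

Lemma pochR_add (x : R) (m n : nat) :
  pochR x (m + n) = pochR x m * pochR (x + INR m) n.
Proof.
induction n as [|n IH]; simpl.
- rewrite Nat.add_0_r. ring.
- rewrite Nat.add_succ_r. simpl. rewrite IH, plus_INR. ring.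
Qed.

Lemma Gamma_poch (x : R) (n : nat) : 0 < x -> Gamma (x + INR n) = pochR x n * Gamma x.
Proof.
intros Hx. induction n as [|n IH].
- simpl. rewrite Rplus_0_r. ring.
- rewrite S_INR, <- Rplus_assoc. pose proof (pos_INR n).
  rewrite Gamma_succ by lra. rewrite IH. simpl. ring.
Qed.

Definition binser_coef (p : R) (n : nat) : R := pochR p n / INR (fact n).

Lemma binser_coef_pos (p : R) (n : nat) : 0 < p -> 0 < binser_coef p n.
Proof.
intros Hp. apply Rdiv_lt_0_compat; [now apply pochR_pos|apply INR_fact_lt_0].
Qed.

Lemma binser_coef_S (p : R) (n : nat) :
  INR (S n) * binser_coef p (S n) = (p + INR n) * binser_coef p n.
Proof.
unfold binser_coef. rewrite fact_simpl, mult_INR. simpl pochR.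
field. split; [apply INR_fact_neq_0|now apply not_0_INR].
Qed.

Lemma binser_CV_radius (p : R) : 0 < p -> CV_radius (binser_coef p) = 1.
Proof.
intros Hp. rewrite <- Rinv_1. apply CV_radius_finite_DAlembert; [|lra|].
- intros n. apply Rgt_not_eq. now apply binser_coef_pos.
- apply is_lim_seq_ext with (fun n => 1 + (p - 1) * / INR (S n)).
  + intros n. pose proof (binser_coef_S p n) as H.
    pose proof (binser_coef_pos p n Hp). pose proof (binser_coef_pos p (S n) Hp).
    assert (HS : 0 < INR (S n)) by (apply lt_0_INR; lia).
    replace (binser_coef p (S n)) with ((p + INR n) * binser_coef p n / INR (S n)).
    2: { rewrite <- H. field. lra. }
    pose proof (pos_INR n).
    rewrite Rabs_right.
    * rewrite S_INR in *. field. lra.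
    * apply Rle_ge, Rlt_le, Rdiv_lt_0_compat; auto.
      apply Rdiv_lt_0_compat; auto. apply Rmult_lt_0_compat; lra.
  + replace (Finite 1) with (Finite (1 + (p - 1) * 0)) by (f_equal; ring).
    apply is_lim_seq_plus'; [apply is_lim_seq_const|].
    apply (is_lim_seq_scal_l _ (p - 1) 0).
    apply (is_lim_seq_incr_1 (fun n => / INR n)).
    replace (Finite 0) with (Rbar_inv p_infty) by reflexivity.
    apply is_lim_seq_inv; [apply is_lim_seq_INR|discriminate].
Qed.

Lemma binser_ode (p x : R) : 0 < p -> Rabs x < 1 ->
  (1 - x) * PSeries (PS_derive (binser_coef p)) x = p * PSeries (binser_coef p) x.
Proof.
intros Hp Hx.
assert (E1 : ex_pseries (PS_derive (binser_coef p)) x).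
{ apply CV_radius_inside. now rewrite CV_radius_derive, binser_CV_radius. }
rewrite <- (PSeries_scal p (binser_coef p)).
replace ((1 - x) * PSeries (PS_derive (binser_coef p)) x) with
  (PSeries (PS_derive (binser_coef p)) x - x * PSeries (PS_derive (binser_coef p)) x) by ring.
rewrite <- PSeries_incr_1, <- PSeries_minus; [|exact E1|].
2: now apply ex_pseries_incr_1.
apply PSeries_ext. intros n. unfold PS_minus, PS_plus, PS_opp, PS_scal, PS_incr_1, PS_derive.
rewrite binser_coef_S. destruct n as [|n].
- change ((p + INR 0) * binser_coef p 0 + - 0 = p * binser_coef p 0). simpl. ring.
- change ((p + INR (S n)) * binser_coef p (S n) + - (INR (S n) * binser_coef p (S n))
   = p * binser_coef p (S n)). ring.
Qed.

Lemma binomial_PSeries (p x : R) : 0 < p -> Rabs x < 1 ->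
  PSeries (binser_coef p) x = Rpower (1 - x) (- p).
Proof.
intros Hp Hx.
set (F := fun x => PSeries (binser_coef p) x * Rpower (1 - x) p).
assert (HF : forall t, Rabs t < 1 -> is_derive F t 0).
{ intros t Ht. pose proof (Rabs_def2 _ _ Ht) as Ht'.
  pose proof (binser_ode p t Hp Ht) as Hode.
  assert (H1 : is_derive (PSeries (binser_coef p)) t (PSeries (PS_derive (binser_coef p)) t)).
  { apply is_derive_PSeries. now rewrite binser_CV_radius. }
  assert (H2 : is_derive (fun x => Rpower (1 - x) p) t (- p * Rpower (1 - t) (p - 1))).
  { rewrite Rpower_pred by lra. unfold Rpower. auto_derive; [lra|].
    replace (1 + - t) with (1 - t) by ring. field. lra. }
  pose proof (is_derive_mult _ _ _ _ _ H1 H2 Rmult_comm) as H3.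
  unfold F. replace 0 with
    (plus (mult (PSeries (PS_derive (binser_coef p)) t) (Rpower (1 - t) p))
       (mult (PSeries (binser_coef p) t) (- p * Rpower (1 - t) (p - 1)))); auto.
  unfold plus, mult; simpl. rewrite Rpower_pred by lra.
  replace (PSeries (PS_derive (binser_coef p)) t) with
    (p * PSeries (binser_coef p) t / (1 - t)) by (rewrite <- Hode; field; lra).
  field. lra. }
assert (HF0 : F x = F 0).
{ destruct (Rtotal_order x 0) as [H|[->|H]]; auto.
  - apply (eq_is_derive F); auto. intros t Ht. apply HF.
    apply Rabs_def2 in Hx. apply Rabs_def1; lra.
  - symmetry. apply (eq_is_derive F); auto. intros t Ht. apply HF.
    apply Rabs_def2 in Hx. apply Rabs_def1; lra. }
unfold F in HF0. rewrite Rminus_0_r, PSeries_0 in HF0.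
assert (E1 : Rpower 1 p = 1).
{ unfold Rpower. rewrite ln_1, Rmult_0_r. apply exp_0. }
rewrite E1 in HF0. unfold binser_coef at 2 in HF0. simpl in HF0.
rewrite Rpower_Ropp. pose proof (Rpower_pos (1 - x) p).
apply Rmult_eq_reg_r with (Rpower (1 - x) p); [|lra].
rewrite HF0. field. lra.
Qed.

Lemma binomial_series (p x : R) : 0 < p -> Rabs x < 1 ->
  is_series (fun n => binser_coef p n * x ^ n) (Rpower (1 - x) (- p)).
Proof.
intros Hp Hx. apply is_pseries_R. rewrite <- binomial_PSeries by auto.
apply PSeries_correct, CV_radius_inside. now rewrite binser_CV_radius.
Qed.

Lemma sum_n_le_series (a : nat -> R) (l : R) (n : nat) : (forall k, 0 <= a k) ->
  is_series a l -> sum_n a n <= l.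
Proof.
intros Ha Hl. apply (is_lim_seq_incr_compare (sum_n a)); auto.
intros k. rewrite sum_Sn. unfold plus; simpl. pose proof (Ha (S k)). lra.
Qed.

Lemma series_tail_bound (f M : nat -> R) (F S : R) (n : nat) :
  (forall k, Rabs (f k) <= M k) -> is_series f F -> is_series M S ->
  Rabs (F - sum_n f n) <= S - sum_n M n.
Proof.
intros HfM Hf HM.
assert (H1 : is_lim_seq (fun k => Rabs (sum_n f k - sum_n f n)) (Rabs (F - sum_n f n))).
{ apply (is_lim_seq_abs _ (F - sum_n f n)).
  apply is_lim_seq_minus'; [exact Hf|apply is_lim_seq_const]. }
assert (H2 : is_lim_seq (fun k => sum_n M k - sum_n M n) (S - sum_n M n)).
{ apply is_lim_seq_minus'; [exact HM|apply is_lim_seq_const]. }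
assert (Hle : Rbar_le (Rabs (F - sum_n f n)) (S - sum_n M n)); [|exact Hle].
apply (is_lim_seq_le_loc _ _ _ _) with (2 := H1) (3 := H2).
exists n. intros k Hk. induction Hk as [|k Hk IH].
- rewrite !Rminus_diag, Rabs_R0. lra.
- rewrite !sum_Sn. unfold plus; simpl.
  replace (sum_n f k + f (Datatypes.S k) - sum_n f n) with
    ((sum_n f k - sum_n f n) + f (Datatypes.S k)) by ring.
  apply Rle_trans with (1 := Rabs_triang _ _).
  generalize (HfM (Datatypes.S k)). lra.
Qed.

Definition beta_mean (x y : R) (phi : R -> R) : R := beta_int x y phi / Beta x y.

Section BetaMean.
Variables x y : R.
Hypotheses (Hx : 0 < x) (Hy : 0 < y).

Let HB : 0 < Beta x y := Beta_pos x y Hx Hy.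

Lemma beta_mean_ext (f g : R -> R) : bounded_continuous f ->
  (forall t, 0 < t < 1 -> f t = g t) -> beta_mean x y f = beta_mean x y g.
Proof. intros Hf H. unfold beta_mean. f_equal. now apply beta_int_ext. Qed.

Lemma beta_mean_plus (f g : R -> R) : bounded_continuous f -> bounded_continuous g ->
  beta_mean x y (fun t => f t + g t) = beta_mean x y f + beta_mean x y g.
Proof.
intros Hf Hg. unfold beta_mean. rewrite beta_int_plus by auto. field. lra.
Qed.

Lemma beta_mean_scal (k : R) (f : R -> R) : bounded_continuous f ->
  beta_mean x y (fun t => k * f t) = k * beta_mean x y f.
Proof.
intros Hf. unfold beta_mean. rewrite beta_int_scal by auto. field. lra.
Qed.

Lemma beta_mean_1 : beta_mean x y (fun _ => 1) = 1.
Proof. unfold beta_mean, Beta. apply Rinv_r. apply Rgt_not_eq, HB. Qed.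

Lemma beta_mean_const (k : R) : beta_mean x y (fun _ => k) = k.
Proof.
rewrite (beta_mean_ext (fun _ => k) (fun t => k * 1)).
- rewrite (beta_mean_scal k (fun _ => 1)) by apply bounded_continuous_const.
  rewrite beta_mean_1. ring.
- apply bounded_continuous_const.
- intros; ring.
Qed.

Lemma beta_mean_le (f g : R -> R) : bounded_continuous f -> bounded_continuous g ->
  (forall t, 0 < t < 1 -> f t <= g t) -> beta_mean x y f <= beta_mean x y g.
Proof.
intros Hf Hg H. apply Rmult_le_compat_r.
- now apply Rlt_le, Rinv_0_lt_compat.
- now apply beta_int_le.
Qed.

Lemma beta_mean_sum_n (f : nat -> R -> R) (n : nat) :
  (forall k, bounded_continuous (f k)) ->
  beta_mean x y (fun t => sum_n (fun k => f k t) n) = sum_n (fun k => beta_mean x y (f k)) n.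
Proof.
intros Hf. induction n as [|n IH].
- rewrite sum_O. apply beta_mean_ext; [now apply bounded_continuous_sum_n|].
  intros t Ht. now rewrite sum_O.
- rewrite sum_Sn, <- IH. unfold plus; simpl.
  rewrite <- beta_mean_plus; auto using bounded_continuous_sum_n.
  apply beta_mean_ext; [now apply bounded_continuous_sum_n|].
  intros t Ht. now rewrite sum_Sn.
Qed.

Lemma beta_mean_series (f : nat -> R -> R) (F : R -> R) (M : nat -> R) (S : R) :
  (forall k, bounded_continuous (f k)) -> bounded_continuous F ->
  (forall k t, 0 < t < 1 -> Rabs (f k t) <= M k) -> is_series M S ->
  (forall t, 0 < t < 1 -> is_series (fun k => f k t) (F t)) ->
  is_series (fun k => beta_mean x y (f k)) (beta_mean x y F).
Proof.
intros Hf HF HfM HM HS.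
assert (HD : forall n, Rabs (sum_n (fun k => beta_mean x y (f k)) n - beta_mean x y F)
   <= S - sum_n M n).
{ intros n. rewrite <- beta_mean_sum_n by auto.
  assert (Hsn : bounded_continuous (fun t => sum_n (fun k => f k t) n))
    by now apply bounded_continuous_sum_n.
  pose proof (bounded_continuous_const (S - sum_n M n)) as Hc.
  assert (Hb : forall t, 0 < t < 1 ->
    Rabs (F t - sum_n (fun k => f k t) n) <= S - sum_n M n).
  { intros t Ht. apply series_tail_bound; auto. }
  assert (H1 : beta_mean x y F <=
    beta_mean x y (fun t => sum_n (fun k => f k t) n + (S - sum_n M n))).
  { apply beta_mean_le; auto.
    - now apply bounded_continuous_plus with (g := fun _ => S - sum_n M n).
    - intros t Ht. generalize (Hb t Ht). intros H. apply Rabs_le_between in H. lra. }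
  assert (H2 : beta_mean x y (fun t => sum_n (fun k => f k t) n) <=
    beta_mean x y (fun t => F t + (S - sum_n M n))).
  { apply beta_mean_le; auto.
    - now apply bounded_continuous_plus with (g := fun _ => S - sum_n M n).
    - intros t Ht. generalize (Hb t Ht). intros H. apply Rabs_le_between in H. lra. }
  rewrite (beta_mean_plus _ (fun _ => S - sum_n M n)), beta_mean_const in H1 by auto.
  rewrite (beta_mean_plus F (fun _ => S - sum_n M n)), beta_mean_const in H2 by auto.
  apply Rabs_le. lra. }
assert (HL : is_lim_seq (sum_n (fun k => beta_mean x y (f k))) (beta_mean x y F));
  [|exact HL].
apply is_lim_seq_spec. intros eps.
destruct (proj2 (is_lim_seq_spec (sum_n M) S) HM eps) as [N HN].
exists N. intros n Hn. apply Rle_lt_trans with (1 := HD n).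
generalize (HN n Hn). intros H. apply Rabs_def2 in H. lra.
Qed.

Lemma beta_mean_shift_r (z : R) (f : R -> R) : 0 <= z -> bounded_continuous f ->
  beta_mean x y (fun t => Rpower (1 - t) z * f t) =
  Gamma (y + z) * Gamma (x + y) / (Gamma y * Gamma (x + (y + z))) * beta_mean x (y + z) f.
Proof.
intros Hz Hf. rewrite <- Beta_ratio by auto. unfold beta_mean.
rewrite beta_int_add_r by auto.
pose proof (Beta_pos x (y + z) Hx ltac:(lra)). field. lra.
Qed.

End BetaMean.

Lemma beta_mean_pow (x y : R) (n : nat) (f : R -> R) : 0 < x -> 0 < y ->
  bounded_continuous f ->
  beta_mean x y (fun t => t ^ n * f t) =
  pochR x n / pochR (x + y) n * beta_mean (x + INR n) y f.
Proof.
intros Hx Hy. revert f. induction n as [|n IH]; intros f Hf.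
- simpl. rewrite Rplus_0_r. unfold Rdiv. rewrite Rinv_1, !Rmult_1_l.
  apply beta_mean_ext; auto; [|intros; ring].
  apply (bounded_continuous_scal 1); auto.
- assert (H1 : bounded_continuous (fun t => t * f t)).
  { now apply (bounded_continuous_mult (fun t => t)), Hf; apply bounded_continuous_id. }
  rewrite (beta_mean_ext x y Hx Hy (fun t => t ^ S n * f t) (fun t => t ^ n * (t * f t))); auto.
  + rewrite IH by auto. rewrite S_INR, <- Rplus_assoc.
    pose proof (pos_INR n) as Hn. simpl pochR.
    unfold beta_mean. rewrite <- beta_int_succ_l by (auto; lra).
    rewrite Beta_succ_l by lra.
    pose proof (Beta_pos (x + INR n) y ltac:(lra) Hy).
    pose proof (pochR_pos (x + y) n ltac:(lra)). field. repeat split; lra.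
  + apply (bounded_continuous_mult (fun t => t ^ S n)); auto.
    apply (bounded_continuous_pow (fun t => t)), bounded_continuous_id.
  + intros t Ht. simpl. ring.
Qed.

(** * Complex power series *)

Notation is_Cseries := (is_series (K := C_AbsRing) (V := C_NormedModule)).
Notation is_Cpseries := (is_pseries (K := C_AbsRing) (V := C_NormedModule)).
Notation is_Cderive := (is_derive (K := C_AbsRing) (V := C_NormedModule)).

Definition CPS (u : nat -> C) (z : C) : C :=
  iota (T := C_CompleteNormedModule) (is_Cpseries u z).

Lemma is_Cseries_unique (a : nat -> C) (l1 l2 : C) :
  is_Cseries a l1 -> is_Cseries a l2 -> l1 = l2.
Proof.
intros H1 H2.
exact (filterlim_locally_unique (K := C_AbsRing) (V := C_NormedModule) _ _ _ H1 H2).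
Qed.

Lemma CPS_unique (u : nat -> C) (z l : C) : is_Cpseries u z l -> CPS u z = l.
Proof.
intros H. apply (iota_unique (V := C_CompleteNormedModule) (is_Cpseries u z)); auto.
intros y Hy. now apply (is_Cseries_unique _ _ _ Hy).
Qed.

Lemma pow_n_Cpow (z : C) (n : nat) : pow_n (K := C_Ring) z n = Cpow z n.
Proof. induction n as [|n IH]; simpl; [auto|]. now rewrite <- IH. Qed.

Lemma is_Cpseries_Cpow (u : nat -> C) (z l : C) :
  is_Cpseries u z l <-> is_Cseries (fun n => (u n * Cpow z n)%C) l.
Proof.
assert (E : forall n, scal (pow_n (K := C_AbsRing) z n) (u n : C_NormedModule)
   = (u n * Cpow z n)%C).
{ intros n. rewrite <- pow_n_Cpow.
  change (pow_n (K := C_Ring) z n * u n = u n * pow_n (K := C_Ring) z n)%C. ring. }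
split; apply is_series_ext; intros n; auto.
Qed.

Lemma Cmod_series_le (a : nat -> C) (b : nat -> R) (l : C) (s : R) :
  (forall n, Cmod (a n) <= b n) -> is_Cseries a l -> is_series b s -> Cmod l <= s.
Proof.
intros Hab Ha Hb.
assert (H1 : is_lim_seq (fun n => Cmod (sum_n (G := C_NormedModule) a n)) (Cmod l)).
{ eapply filterlim_comp; [exact Ha|].
  apply (filterlim_norm (K := C_AbsRing) (V := C_NormedModule)). }
assert (Hle : Rbar_le (Cmod l) s); [|exact Hle].
apply (is_lim_seq_le _ (sum_n b) _ _) with (2 := H1) (3 := Hb).
intros n. induction n as [|n IH].
- rewrite !sum_O. auto.
- rewrite !sum_Sn. apply Rle_trans with (1 := Cmod_triangle _ _).
  apply Rplus_le_compat; auto.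
Qed.

Lemma ex_Cpseries (u : nat -> C) (z : C) :
  Rbar_lt (Cmod z) (CV_radius (fun n => Cmod (u n))) -> is_Cpseries u z (CPS u z).
Proof.
intros H.
assert (E : ex_series (K := C_AbsRing) (V := C_CompleteNormedModule)
  (fun n => (u n * Cpow z n)%C)).
{ apply (ex_series_le (K := C_AbsRing) (V := C_CompleteNormedModule)) with
    (fun n => Rabs (Cmod (u n) * Cmod z ^ n)).
  - intros n. change (Cmod (u n * Cpow z n) <= Rabs (Cmod (u n) * Cmod z ^ n)).
    rewrite Cmod_mult, Cmod_pow. apply Rle_abs.
  - apply CV_disk_inside. rewrite Rabs_right; auto. apply Rle_ge, Cmod_ge_0. }
destruct E as [l E]. apply (proj2 (is_Cpseries_Cpow u z l)) in E.
now rewrite (CPS_unique _ _ _ E).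
Qed.

Lemma Rbar_le_CV_radius (a : nat -> R) (r : R) :
  (forall x, 0 <= x < r -> exists M, forall n, Rabs (a n * x ^ n) <= M) ->
  Rbar_le r (CV_radius a).
Proof.
intros H. destruct (Rle_dec r 0) as [Hr|Hr].
{ apply Rbar_le_trans with 0; [exact Hr|apply CV_radius_ge_0]. }
assert (Hr0 : 0 < r) by lra.
destruct (Rbar_le_dec r (CV_radius a)) as [Hd|Hd]; auto. exfalso.
apply Rbar_not_le_lt in Hd.
destruct (CV_radius_bounded a) as [Hub _].
pose proof (CV_radius_ge_0 a) as H0.
destruct (CV_radius a) as [c| |]; simpl in *; try easy.
destruct (H ((c + r) / 2)) as [M HM]; [lra|].
specialize (Hub ((c + r) / 2) (ex_intro _ M HM)). simpl in Hub. lra.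
Qed.

Lemma is_Cderive_quadratic (f : C -> C) (z l : C) (K r : R) : 0 < r ->
  (forall w, Cmod (w - z) < r ->
     Cmod (f w - f z - (w - z) * l) <= K * Cmod (w - z) ^ 2) ->
  is_Cderive f z l.
Proof.
intros Hr HK. split.
- apply (is_linear_scal_l (K := C_AbsRing) (V := C_NormedModule)).
- intros x Hx.
  assert (Ex : z = x).
  { apply (is_filter_lim_locally_unique (K := C_AbsRing) (V := AbsRing_NormedModule C_AbsRing)); auto. }
  subst x. intros eps.
  set (K' := Rmax K 1).
  assert (HK1 : 0 < K') by (eapply Rlt_le_trans; [apply Rlt_0_1|apply Rmax_r]).
  assert (Hd : 0 < Rmin r (eps / K')).
  { apply Rmin_pos; auto. apply Rdiv_lt_0_compat; auto. apply eps. }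
  exists (mkposreal _ Hd). intros w Hw.
  change (Cmod (w - z) < Rmin r (eps / K')) in Hw.
  change (Cmod (f w - f z - (w - z) * l) <= eps * Cmod (w - z)).
  apply Rle_trans with (1 := HK w (Rlt_le_trans _ _ _ Hw (Rmin_l _ _))).
  pose proof (Rlt_le_trans _ _ _ Hw (Rmin_r _ _)) as H2.
  pose proof (Cmod_ge_0 (w - z)) as H3.
  replace (K * Cmod (w - z) ^ 2) with (K * Cmod (w - z) * Cmod (w - z)) by ring.
  apply Rmult_le_compat_r; auto.
  apply Rle_trans with (K' * Cmod (w - z)).
  + apply Rmult_le_compat_r; auto. apply Rmax_l.
  + replace (pos eps) with (K' * (eps / K')) by (field; lra).
    apply Rmult_le_compat_l; lra.
Qed.

(* The linear term is [n z^(n-1)], read as [0] for [n = 0]. *)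
Lemma Cpow_taylor_bound (z w : C) (r : R) (n : nat) :
  Cmod z <= r -> Cmod w <= r ->
  r ^ 2 * Cmod (Cpow w n - Cpow z n - (w - z) * (RtoC (INR n) * Cpow z (n - 1)))
   <= INR n ^ 2 * r ^ n * Cmod (w - z) ^ 2.
Proof.
intros Hz Hw.
assert (Hr : 0 <= r) by (apply Rle_trans with (2 := Hz), Cmod_ge_0).
induction n as [|n IH].
- simpl. replace (1 - 1 - (w - z) * (RtoC 0 * 1))%C with (RtoC 0) by ring.
  rewrite Cmod_0. lra.
- set (h := (w - z)%C) in *.
  replace (Cpow w (S n) - Cpow z (S n) - h * (RtoC (INR (S n)) * Cpow z (S n - 1)))%C
   with (w * (Cpow w n - Cpow z n - h * (RtoC (INR n) * Cpow z (n - 1)))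
       + RtoC (INR n) * Cpow z (n - 1) * (h * h))%C.
  2: { rewrite S_INR, RtoC_plus. simpl Cpow. rewrite Nat.sub_0_r.
       destruct n as [|n].
       - simpl. unfold h. ring.
       - simpl (S n - 1)%nat. rewrite Nat.sub_0_r. simpl Cpow. unfold h. ring. }
  apply Rle_trans with (r * (INR n ^ 2 * r ^ n * Cmod h ^ 2) + INR n * r ^ S n * Cmod h ^ 2).
  + apply Rle_trans with (r ^ 2 * (Cmod w * Cmod (Cpow w n - Cpow z n - h * (RtoC (INR n) * Cpow z (n - 1)))
       + INR n * Cmod z ^ (n - 1) * Cmod h ^ 2)).
    * apply Rmult_le_compat_l; [apply pow_le; auto|].
      apply Rle_trans with (1 := Cmod_triangle _ _).
      rewrite !Cmod_mult, Cmod_pow, Cmod_R, (Rabs_right (INR n)) by apply Rle_ge, pos_INR.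
      right; ring.
    * rewrite Rmult_plus_distr_l. apply Rplus_le_compat.
      -- rewrite <- Rmult_assoc, (Rmult_comm (r ^ 2)), Rmult_assoc.
         apply Rmult_le_compat; auto using Cmod_ge_0.
         apply Rmult_le_pos; [apply pow_le; auto|apply Cmod_ge_0].
      -- rewrite <- Rmult_assoc. apply Rmult_le_compat_r; [apply pow_le, Cmod_ge_0|].
         destruct n as [|n]; [simpl; lra|].
         replace (S n - 1)%nat with n by lia.
         replace (r ^ 2 * (INR (S n) * Cmod z ^ n)) with (INR (S n) * (r ^ 2 * Cmod z ^ n)) by ring.
         apply Rmult_le_compat_l; [apply pos_INR|].
         replace (r ^ S (S n)) with (r ^ 2 * r ^ n) by (simpl; ring).
         apply Rmult_le_compat_l; [apply pow_le; auto|].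
         apply pow_incr. split; auto. apply Cmod_ge_0.
  + rewrite S_INR. pose proof (pos_INR n).
    replace (r * (INR n ^ 2 * r ^ n * Cmod h ^ 2) + INR n * r ^ S n * Cmod h ^ 2) with
     ((INR n ^ 2 + INR n) * (r ^ S n * Cmod h ^ 2)) by (simpl; ring).
    rewrite Rmult_assoc. apply Rmult_le_compat_r.
    * apply Rmult_le_pos; apply pow_le; auto. apply Cmod_ge_0.
    * nra.
Qed.

Definition CPS_derive (u : nat -> C) (n : nat) : C := (RtoC (INR (S n)) * u (S n))%C.

Lemma CV_radius_CPS_derive (u : nat -> C) :
  CV_radius (fun n => Cmod (CPS_derive u n)) = CV_radius (fun n => Cmod (u n)).
Proof.
rewrite <- (CV_radius_derive (fun n => Cmod (u n))). apply CV_radius_ext. intros n.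
unfold CPS_derive, PS_derive. rewrite Cmod_mult, Cmod_R, Rabs_right; auto.
apply Rle_ge, pos_INR.
Qed.

Lemma ex_series_square_index (a : nat -> R) (r : R) :
  Rbar_lt (Rabs r) (CV_radius a) -> ex_series (fun n => INR n ^ 2 * (a n * r ^ n)).
Proof.
intros Hr.
apply ex_series_ext with (fun n => PS_incr_1 (PS_derive (PS_incr_1 (PS_derive a))) n * r ^ n).
- intros n. destruct n as [|n]; unfold PS_incr_1, PS_derive.
  + change (0 * r ^ 0 = INR 0 ^ 2 * (a 0%nat * r ^ 0)). simpl. ring.
  + change (INR (S n) * (INR (S n) * a (S n)) * r ^ S n
      = INR (S n) ^ 2 * (a (S n) * r ^ S n)). ring.
- apply ex_pseries_R, CV_radius_inside.
  now rewrite CV_radius_incr_1, CV_radius_derive, CV_radius_incr_1, CV_radius_derive.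
Qed.

Lemma is_derive_CPS (u : nat -> C) (z0 z : C) :
  Rbar_lt (Cmod (z - z0)) (CV_radius (fun n => Cmod (u n))) ->
  is_Cderive (fun w => CPS u (w - z0)) z (CPS (CPS_derive u) (z - z0)).
Proof.
intros Hz.
assert (exists r, Cmod (z - z0) < r /\ Rbar_lt r (CV_radius (fun n => Cmod (u n)))) as [r [Hr1 Hr2]].
{ destruct (CV_radius (fun n => Cmod (u n))) as [c| |]; simpl in *; try easy.
  - exists ((Cmod (z - z0) + c) / 2). lra.
  - exists (Cmod (z - z0) + 1). split; [lra|easy]. }
pose proof (Cmod_ge_0 (z - z0)) as Hz0.
destruct (ex_series_square_index (fun n => Cmod (u n)) r) as [s Hs].
{ rewrite Rabs_right; auto. lra. }
apply is_Cderive_quadratic with (s / r ^ 2) (r - Cmod (z - z0)); [lra|].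
intros w Hw.
replace (w - z)%C with ((w - z0) - (z - z0))%C in * by ring.
set (W := (w - z0)%C) in *. set (Z := (z - z0)%C) in *.
assert (HW : Cmod W < r).
{ replace W with ((W - Z) + Z)%C by ring.
  apply Rle_lt_trans with (1 := Cmod_triangle _ _). lra. }
assert (EZ : is_Cpseries u Z (CPS u Z)).
{ apply ex_Cpseries. exact Hz. }
assert (EW : is_Cpseries u W (CPS u W)).
{ apply ex_Cpseries. eapply Rbar_lt_trans; [|exact Hr2]. exact HW. }
assert (ED : is_Cpseries (CPS_derive u) Z (CPS (CPS_derive u) Z)).
{ apply ex_Cpseries. rewrite CV_radius_CPS_derive. exact Hz. }
apply is_Cpseries_Cpow in EZ. apply is_Cpseries_Cpow in EW. apply is_Cpseries_Cpow in ED.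
assert (ED' : is_Cseries (fun n => (RtoC (INR n) * u n * Cpow Z (n - 1))%C)
   (CPS (CPS_derive u) Z)).
{ apply is_series_decr_1.
  match goal with |- is_series _ ?l => replace l with (CPS (CPS_derive u) Z) end.
  - eapply is_series_ext; [|exact ED]. intros n. unfold CPS_derive.
    replace (S n - 1)%nat with n by lia. reflexivity.
  - change (CPS (CPS_derive u) Z =
      (CPS (CPS_derive u) Z + - (RtoC 0 * u 0%nat * 1))%C). ring. }
pose proof (is_series_minus _ _ _ _ (is_series_minus _ _ _ _ EW EZ)
  (is_series_scal (W - Z)%C _ _ ED')) as HT.
pose proof (is_series_scal (Cmod (W - Z) ^ 2 / r ^ 2) _ _ Hs) as HB.
replace (s / r ^ 2 * Cmod (W - Z) ^ 2) with (scal (Cmod (W - Z) ^ 2 / r ^ 2) s).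
2: { unfold scal; simpl; unfold mult; simpl. field. lra. }
refine (Cmod_series_le _ _ _ _ _ HT HB).
intros n. unfold scal; simpl; unfold mult; simpl.
change (Cmod ((u n * Cpow W n - u n * Cpow Z n)
    - (W - Z) * (RtoC (INR n) * u n * Cpow Z (n - 1)))
  <= Cmod (W - Z) ^ 2 / r ^ 2 * (INR n ^ 2 * (Cmod (u n) * r ^ n))).
replace ((u n * Cpow W n - u n * Cpow Z n)
    - (W - Z) * (RtoC (INR n) * u n * Cpow Z (n - 1)))%C with
  (u n * (Cpow W n - Cpow Z n - (W - Z) * (RtoC (INR n) * Cpow Z (n - 1))))%C by ring.
rewrite Cmod_mult.
pose proof (Cpow_taylor_bound Z W r n ltac:(lra) ltac:(lra)) as H.
assert (Hr : 0 < r ^ 2) by (apply pow_lt; lra).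
apply Rmult_le_reg_l with (r ^ 2); auto.
replace (r ^ 2 * (Cmod (W - Z) ^ 2 / r ^ 2 * (INR n ^ 2 * (Cmod (u n) * r ^ n))))
 with (Cmod (u n) * (INR n ^ 2 * r ^ n * Cmod (W - Z) ^ 2)) by (field; lra).
rewrite <- Rmult_assoc, (Rmult_comm (r ^ 2)), Rmult_assoc.
apply Rmult_le_compat_l; auto. apply Cmod_ge_0.
Qed.

Lemma is_derive_CPS_0 (u : nat -> C) (z : C) :
  Rbar_lt (Cmod z) (CV_radius (fun n => Cmod (u n))) ->
  is_Cderive (CPS u) z (CPS (CPS_derive u) z).
Proof.
intros Hz. replace z with (z - 0)%C in Hz by ring.
pose proof (is_derive_CPS u 0 z Hz) as H.
replace (z - 0)%C with z in H by ring.
eapply is_derive_ext; [|exact H]. intros t. simpl. f_equal. ring.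
Qed.

(** * Re-expansion of a power series at -1 *)

Notation csum := (sum_n (G := C_NormedModule)).

(* [ring] does not see through the carrier of [C_NormedModule]. *)
Ltac Cring := match goal with |- @eq _ ?x ?y => change (@eq C x y); ring end.

Lemma csum_S (a : nat -> C) (n : nat) : csum a (S n) = (csum a n + a (S n))%C.
Proof. apply (sum_Sn (G := C_NormedModule)). Qed.

Lemma csum_ext (a b : nat -> C) (n : nat) : (forall k, a k = b k) -> csum a n = csum b n.
Proof. apply (sum_n_ext (G := C_NormedModule)). Qed.

Lemma csum_plus (a b : nat -> C) (n : nat) :
  csum (fun k => (a k + b k)%C) n = (csum a n + csum b n)%C.
Proof. apply (sum_n_plus (G := C_NormedModule)). Qed.

Lemma csum_mult_l (c : C) (a : nat -> C) (n : nat) :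
  csum (fun k => (c * a k)%C) n = (c * csum a n)%C.
Proof.
induction n as [|n IH]; [now rewrite !sum_O|]. rewrite !csum_S, IH. Cring.
Qed.

Lemma csum_RtoC (a : nat -> R) (n : nat) : csum (fun k => RtoC (a k)) n = RtoC (sum_n a n).
Proof.
induction n as [|n IH]; [now rewrite !sum_O|].
rewrite csum_S, sum_Sn, IH. now rewrite <- RtoC_plus.
Qed.

Lemma csum_shift (a : nat -> C) (n : nat) :
  csum a (S n) = (a 0%nat + csum (fun k => a (S k)) n)%C.
Proof.
induction n as [|n IH].
- rewrite csum_S, !sum_O. reflexivity.
- rewrite csum_S, IH, csum_S. Cring.
Qed.

Fixpoint pascal_coef (k n : nat) : R :=
  match k, n with
  | _, O => 1
  | O, S _ => 0
  | S k', S n' => pascal_coef k' n' + pascal_coef k' n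
  end.

Lemma pascal_0 (k : nat) : pascal_coef k 0 = 1.
Proof. now destruct k. Qed.

Lemma pascal_gt (k n : nat) : (k < n)%nat -> pascal_coef k n = 0.
Proof.
revert n. induction k as [|k IH]; intros [|n] Hn; simpl; try lia; auto.
rewrite !IH by lia. ring.
Qed.

Lemma pascal_ge_0 (k n : nat) : 0 <= pascal_coef k n.
Proof.
revert n. induction k as [|k IH]; intros [|n]; simpl; try lra.
pose proof (IH n). pose proof (IH (S n)). lra.
Qed.

Lemma pascal_fact (n j : nat) :
  pascal_coef (n + j) n * (INR (fact n) * INR (fact j)) = INR (fact (n + j)).
Proof.
remember (n + j)%nat as m eqn:Hm. revert n j Hm.
induction m as [|m IH]; intros n j Hm.
- assert (n = 0%nat /\ j = 0%nat) as [-> ->] by lia. simpl. ring.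
- destruct n as [|n].
  { rewrite pascal_0. replace j with (S m) by lia. change (INR (fact 0)) with 1. ring. }
  destruct j as [|j].
  { replace (S n) with (S m) by lia.
    assert (E : pascal_coef (S m) (S m) = 1).
    { clear. induction m as [|m IHm]; [simpl; ring|].
      change (pascal_coef (S (S m)) (S (S m))) with (pascal_coef (S m) (S m) + pascal_coef (S m) (S (S m))).
      rewrite IHm, pascal_gt by lia. ring. }
    rewrite E. change (INR (fact 0)) with 1. ring. }
  change (pascal_coef (S m) (S n)) with (pascal_coef m n + pascal_coef m (S n)).
  pose proof (IH n (S j) ltac:(lia)) as H1. pose proof (IH (S n) j ltac:(lia)) as H2.
  rewrite !fact_simpl, !mult_INR in *.
  replace (INR (S m)) with (INR (S n) + INR (S j)) by (rewrite <- plus_INR; f_equal; lia).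
  transitivity (INR (S n) * (pascal_coef m n * (INR (fact n) * (INR (S j) * INR (fact j))))
    + INR (S j) * (pascal_coef m (S n) * (INR (S n) * INR (fact n) * INR (fact j)))); [ring|].
  rewrite H1, H2. ring.
Qed.

Lemma Cpow_1_plus (z : C) (k N : nat) : (k <= N)%nat ->
  Cpow (1 + z) k = csum (fun n => (RtoC (pascal_coef k n) * Cpow z n)%C) N.
Proof.
revert N. induction k as [|k IH]; intros N HN.
- clear HN. induction N as [|N IHN].
  + rewrite sum_O. simpl. Cring.
  + rewrite csum_S, <- IHN. simpl pascal_coef. simpl. Cring.
- destruct N as [|N]; [lia|].
  rewrite csum_shift, pascal_0.
  rewrite (csum_ext _ (fun n => (z * (RtoC (pascal_coef k n) * Cpow z n)
     + RtoC (pascal_coef k (S n)) * Cpow z (S n))%C)).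
  2: { intros n. change (pascal_coef (S k) (S n)) with (pascal_coef k n + pascal_coef k (S n)).
       rewrite RtoC_plus. simpl Cpow. Cring. }
  rewrite csum_plus, csum_mult_l, <- IH by lia.
  pose proof (IH (S N) ltac:(lia)) as H. rewrite csum_shift, pascal_0 in H.
  simpl Cpow at 1. rewrite Cmult_plus_distr_r. rewrite H at 1. simpl. Cring.
Qed.

Lemma sum_n_reexpand (g : nat -> R) (z : C) (M N : nat) : (M <= N)%nat ->
  csum (fun k => (RtoC (g k) * Cpow (1 + z) k)%C) M =
  csum (fun n => (RtoC (sum_n (fun k => g k * pascal_coef k n)%R M) * Cpow z n)%C) N.
Proof.
induction M as [|M IH]; intros HM.
- rewrite sum_O, (Cpow_1_plus z 0 N) by lia. rewrite <- csum_mult_l.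
  apply csum_ext. intros n. rewrite sum_O, RtoC_mult. Cring.
- rewrite csum_S, IH, (Cpow_1_plus z (S M) N) by lia.
  rewrite <- csum_mult_l, <- csum_plus.
  apply csum_ext. intros n. rewrite sum_Sn. unfold plus; simpl plus.
  rewrite RtoC_plus, RtoC_mult. Cring.
Qed.

Lemma Cmod_csum_le (a : nat -> C) (b : nat -> R) (n : nat) :
  (forall k, Cmod (a k) <= b k) -> Cmod (csum a n) <= sum_n b n.
Proof.
intros H. induction n as [|n IH]; [now rewrite !sum_O|].
rewrite csum_S, sum_Sn. apply Rle_trans with (1 := Cmod_triangle _ _).
now apply Rplus_le_compat.
Qed.

(* The partial sums differ by a polynomial with nonnegative coefficients, which is
   largest in modulus on the positive axis; there the two series agree. *)
Lemma reexpansion (f g : nat -> R) (z l : C) :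
  (forall N n, sum_n (fun k => g k * pascal_coef k n) N <= f n) ->
  (exists s, is_series (fun n => f n * Cmod z ^ n) s /\
             is_series (fun k => g k * (1 + Cmod z) ^ k) s) ->
  is_Cseries (fun k => (RtoC (g k) * Cpow (1 + z) k)%C) l ->
  is_Cseries (fun n => (RtoC (f n) * Cpow z n)%C) l.
Proof.
intros Hfg [s [Hf Hg]] Hl.
set (h := fun N n => sum_n (fun k => g k * pascal_coef k n) N).
assert (HD : forall w N,
  (csum (fun n => (RtoC (f n) * Cpow w n)%C) N - csum (fun k => (RtoC (g k) * Cpow (1 + w) k)%C) N)%C
  = csum (fun n => (RtoC (f n - h N n)%R * Cpow w n)%C) N).
{ intros w N. rewrite (sum_n_reexpand g w N N) by lia. fold (h N).
  rewrite (csum_ext (fun n => (RtoC (f n - h N n)%R * Cpow w n)%C)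
    (fun n => (RtoC (f n) * Cpow w n + (-1) * (RtoC (h N n) * Cpow w n))%C)).
  - rewrite csum_plus, csum_mult_l. unfold h. ring.
  - intros n. rewrite RtoC_minus. ring. }
set (D := fun N => csum (fun n => (RtoC (f n - h N n)%R * Cpow z n)%C) N).
assert (HDle : forall N, Cmod (D N) <=
  sum_n (fun n => f n * Cmod z ^ n) N - sum_n (fun k => g k * (1 + Cmod z) ^ k) N).
{ intros N. apply Rle_trans with (sum_n (fun n => (f n - h N n) * Cmod z ^ n) N).
  - apply Cmod_csum_le. intros n. rewrite Cmod_mult, Cmod_R, Cmod_pow.
    rewrite Rabs_right; [lra|]. generalize (Hfg N n). unfold h. lra.
  - right. apply RtoC_inj. rewrite RtoC_minus, <- !csum_RtoC.
    pose proof (HD (RtoC (Cmod z)) N) as H.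
    rewrite (csum_ext _ (fun n => (RtoC (f n - h N n)%R * Cpow (Cmod z) n)%C)).
    + rewrite <- H. apply (f_equal2 Cminus); apply csum_ext; intros n;
        now rewrite RtoC_mult, RtoC_pow, ?RtoC_plus.
    + intros n. now rewrite RtoC_mult, RtoC_pow. }
assert (HD0 : filterlim D eventually (locally (zero : C_NormedModule))).
{ apply (filterlim_norm_zero (K := C_AbsRing) (V := C_NormedModule)).
  change (is_lim_seq (fun N => Cmod (D N)) 0).
  apply is_lim_seq_le_le with (fun _ => 0)
    (fun N => sum_n (fun n => f n * Cmod z ^ n) N - sum_n (fun k => g k * (1 + Cmod z) ^ k) N).
  - intros N. split; [apply Cmod_ge_0|auto].
  - apply is_lim_seq_const.
  - replace 0 with (s - s) by ring. apply is_lim_seq_minus'; auto. }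
unfold is_series.
apply (filterlim_ext (fun N => plus (D N : C_NormedModule)
   (csum (fun k => (RtoC (g k) * Cpow (1 + z) k)%C) N))).
{ intros N. unfold D. rewrite <- HD. change plus with Cplus. Cring. }
replace (l : C_NormedModule) with (plus (zero : C_NormedModule) l) by apply plus_zero_l.
eapply filterlim_comp_2; [exact HD0|exact Hl|].
apply (filterlim_plus (K := C_AbsRing) (V := C_NormedModule)).
Qed.

Lemma continues_to_unique (f : C -> C) (w1 w2 : C) :
  continues_to f (-1) w1 -> continues_to f (-1) w2 -> w1 = w2.
Proof.
intros (r1 & g1 & Hr1 & Hg1 & Hf1 & <-) (r2 & g2 & Hr2 & Hg2 & Hf2 & <-).
assert (Hin : forall r, 0 < r -> Cdisc (-1) r (-1)).
{ intros r Hr. unfold Cdisc. replace (-1 - -1)%C with (RtoC 0) by ring. now rewrite Cmod_0. }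
pose proof (ex_derive_continuous _ _ (Hg1 _ (Hin _ Hr1))) as C1.
pose proof (ex_derive_continuous _ _ (Hg2 _ (Hin _ Hr2))) as C2.
set (x := fun n => RtoC (-1 + / (INR n + 2))).
assert (Hx : filterlim x eventually (locally (RtoC (-1) : AbsRing_NormedModule C_AbsRing))).
{ intros P [eps HP].
  assert (HL : is_lim_seq (fun n => / (INR n + 2)) 0).
  { replace (Finite 0) with (Rbar_inv p_infty) by reflexivity.
    apply is_lim_seq_inv; [|discriminate].
    apply is_lim_seq_plus with (l1 := p_infty) (l2 := 2);
      [apply is_lim_seq_INR|apply is_lim_seq_const|reflexivity]. }
  destruct (proj2 (is_lim_seq_spec _ _) HL eps) as [N HN].
  exists N. intros n Hn. apply HP. change (Cmod (x n - -1) < eps).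
  replace (x n - -1)%C with (RtoC (/ (INR n + 2))).
  2: { unfold x. rewrite RtoC_plus. ring. }
  rewrite Cmod_R. generalize (HN n Hn). now rewrite Rminus_0_r. }
pose proof (filterlim_comp _ _ _ _ _ _ _ _ Hx C1) as L1.
pose proof (filterlim_comp _ _ _ _ _ _ _ _ Hx C2) as L2.
apply (filterlim_locally_unique (K := C_AbsRing) (V := C_NormedModule)
  (F := eventually) (fun n => g1 (x n))); auto.
apply filterlim_ext_loc with (2 := L2).
assert (Hd : 0 < Rmin r1 r2) by (apply Rmin_pos; auto).
assert (Hev : eventually (fun n => Cmod (x n - -1) < Rmin r1 r2)).
{ apply (Hx (fun w => Cmod (w - -1) < Rmin r1 r2)).
  exists (mkposreal _ Hd). intros w Hw. exact Hw. }
destruct Hev as [N HN]. exists N. intros n Hn. specialize (HN n Hn).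
assert (Hu : unit_disc (x n)).
{ unfold unit_disc, x. rewrite Cmod_R. pose proof (pos_INR n) as Hn0.
  assert (0 < / (INR n + 2)) by (apply Rinv_0_lt_compat; lra).
  assert (/ (INR n + 2) <= / 2) by (apply Rinv_le_contravar; lra).
  apply Rabs_def1; lra. }
rewrite Hf1, Hf2; auto; unfold Cdisc; eapply Rlt_le_trans;
 [exact HN|apply Rmin_r|exact HN|apply Rmin_l].
Qed.

(** * The value of 2F1 at -1 *)

Ltac Rring := match goal with |- @eq _ ?x ?y => change (@eq R x y); ring end.

Lemma RtoC_pochR (x : R) (n : nat) : pochC (RtoC x) n = RtoC (pochR x n).
Proof.
induction n as [|n IH]; simpl; auto. now rewrite IH, RtoC_mult, RtoC_plus.
Qed.

Lemma pochR_1 (n : nat) : pochR 1 n = INR (fact n).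
Proof.
induction n as [|n IH]; auto.
change (pochR 1 (S n)) with (pochR 1 n * (1 + INR n)).
rewrite IH, fact_simpl, mult_INR, S_INR. ring.
Qed.

Lemma pFq_coef_2F1 (p q r : R) (n : nat) : 0 < r ->
  pFq_coef [RtoC p; RtoC q] [RtoC r] n =
  RtoC (binser_coef p n * (pochR q n / pochR r n)).
Proof.
intros Hr. unfold pFq_coef, binser_coef; simpl.
rewrite !RtoC_pochR, pochR_1.
pose proof (pochR_pos r n Hr). pose proof (INR_fact_lt_0 n).
rewrite !RtoC_mult, !RtoC_div by lra. field.
split; intros E; apply RtoC_inj in E; lra.
Qed.

Lemma Rpower_neg_le (u m p : R) : 0 < m -> m <= u -> 0 <= p ->
  Rpower u (- p) <= Rpower m (- p).
Proof.
intros Hm Hu Hp. rewrite !Rpower_Ropp.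
apply Rinv_le_contravar; [apply Rpower_pos|]. apply Rle_Rpower_l; lra.
Qed.

Lemma bounded_continuous_Rpower_neg (h : R -> R) (m p : R) : 0 < m -> 0 <= p ->
  (forall t, 0 < t < 1 -> continuous h t) -> (forall t, 0 < t < 1 -> m <= h t) ->
  bounded_continuous (fun t => Rpower (h t) (- p)).
Proof.
intros Hm Hp Hc Hh. split.
- intros t Ht. apply (continuous_comp h (fun u => Rpower u (- p))); auto.
  apply continuous_Rpower. generalize (Hh t Ht). lra.
- exists (Rpower m (- p)). intros t Ht.
  rewrite Rabs_right by apply Rgt_ge, Rpower_pos.
  apply Rpower_neg_le; auto.
Qed.

Lemma bounded_continuous_1p_neg (p : R) : 0 <= p ->
  bounded_continuous (fun t => Rpower (1 + t) (- p)).
Proof.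
intros Hp. apply (bounded_continuous_Rpower_neg (fun t => 1 + t) 1); try lra.
- intros t _. apply (continuous_plus (V := R_NormedModule));
  [apply continuous_const|apply continuous_id].
- intros; lra.
Qed.

Lemma sum_n_Rmult_l (c : R) (a : nat -> R) (n : nat) :
  sum_n (fun k => c * a k) n = c * sum_n a n.
Proof.
induction n as [|n IH]; [now rewrite !sum_O|].
rewrite !sum_Sn, IH. symmetry. apply Rmult_plus_distr_l.
Qed.

Lemma is_series_scal_R (c : R) (a : nat -> R) (l : R) :
  is_series a l -> is_series (fun n => c * a n) (c * l).
Proof. apply (is_series_scal (K := R_AbsRing) (V := R_NormedModule)). Qed.

Lemma binser_pascal (p : R) (n j : nat) :
  binser_coef p (n + j) * pascal_coef (n + j) n = binser_coef p n * binser_coef (p + INR n) j.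
Proof.
unfold binser_coef. rewrite pochR_add.
rewrite <- (pascal_fact n j).
pose proof (INR_fact_lt_0 n). pose proof (INR_fact_lt_0 j). pose proof (INR_fact_lt_0 (n + j)).
pose proof (pascal_fact n j).
field. repeat split; try lra. intros E. rewrite E in H2. lra.
Qed.

(* Coefficient of [x^n] in the expansion of [(1 - s (1 + x))^(-p) (1 - s)^p] truncated
   at order [N], compared with that of [(1 - (s / (1 - s)) x)^(-p)]. *)
Lemma binser_reexpansion_le (p s : R) (N n : nat) : 0 < p -> 0 <= s < 1 ->
  sum_n (fun k => binser_coef p k * s ^ k * pascal_coef k n) N <=
  binser_coef p n * s ^ n * Rpower (1 - s) (- (p + INR n)).
Proof.
intros Hp Hs. pose proof (pos_INR n) as Hn.
assert (HS : is_series (fun j => binser_coef p n * s ^ n * (binser_coef (p + INR n) j * s ^ j))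
  (binser_coef p n * s ^ n * Rpower (1 - s) (- (p + INR n)))).
{ apply is_series_scal_R. apply binomial_series; [lra|]. rewrite Rabs_right; lra. }
assert (HT : is_series (fun k => binser_coef p k * s ^ k * pascal_coef k n)
  (binser_coef p n * s ^ n * Rpower (1 - s) (- (p + INR n)))).
{ destruct n as [|n].
  - eapply is_series_ext; [|exact HS]. intros j. rewrite pascal_0. simpl pow.
    pose proof (binser_pascal p 0 j) as H. simpl (0 + j)%nat in H.
    rewrite pascal_0 in H. rewrite <- (Rmult_1_r (binser_coef p j)), H. Rring.
  - apply (is_series_decr_n _ (S n)); [lia|].
    match goal with |- is_series _ ?l =>
      replace l with (binser_coef p (S n) * s ^ (S n) * Rpower (1 - s) (- (p + INR (S n)))) end.
    + eapply is_series_ext; [|exact HS]. intros j.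
      change (binser_coef p (S n) * s ^ S n * (binser_coef (p + INR (S n)) j * s ^ j)
       = binser_coef p (S n + j) * s ^ (S n + j) * pascal_coef (S n + j) (S n)).
      rewrite pow_add.
      transitivity (binser_coef p (S n + j) * pascal_coef (S n + j) (S n) * (s ^ S n * s ^ j));
        [rewrite binser_pascal|]; Rring.
    + assert (E : sum_n (fun k => binser_coef p k * s ^ k * pascal_coef k (S n)) n = 0).
      { rewrite (sum_n_ext_loc _ (fun _ => 0)).
        - rewrite sum_n_const. Rring.
        - intros k Hk. rewrite pascal_gt by lia. Rring. }
      change (binser_coef p (S n) * s ^ S n * Rpower (1 - s) (- (p + INR (S n))) =
        binser_coef p (S n) * s ^ S n * Rpower (1 - s) (- (p + INR (S n)))
        + - sum_n (fun k => binser_coef p k * s ^ k * pascal_coef k (S n)) n).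
      rewrite E. Rring. }
apply sum_n_le_series; auto. intros k.
apply Rmult_le_pos; [|apply pascal_ge_0].
apply Rmult_le_pos; [now apply Rlt_le, binser_coef_pos|apply pow_le; lra].
Qed.

Section Hyp2F1.
Variables p q d : R.
Hypotheses (Hp : 0 < p) (Hq : 0 < q) (Hd : 0 < d).

Let phi (k : nat) (t : R) : R := binser_coef p k * (t / (1 + t)) ^ k * Rpower (1 + t) (- p).

Let g (k : nat) : R := beta_mean q d (phi k).

Let f (n : nat) : R := binser_coef p n * (pochR q n / pochR (q + d) n).

Lemma bounded_continuous_phi (k : nat) : bounded_continuous (phi k).
Proof.
apply (bounded_continuous_mult (fun t => binser_coef p k * (t / (1 + t)) ^ k)).
2: apply bounded_continuous_1p_neg; lra.
apply bounded_continuous_scal, (bounded_continuous_pow (fun t => t / (1 + t))). split.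
- intros t Ht. apply (ex_derive_continuous (V := R_NormedModule)). auto_derive. lra.
- exists 1. intros t Ht.
  assert (0 < / (1 + t)) by (apply Rinv_0_lt_compat; lra).
  rewrite Rabs_right.
  + apply Rmult_le_reg_r with (1 + t); [lra|]. unfold Rdiv.
    rewrite Rmult_assoc, Rinv_l by lra. lra.
  + apply Rle_ge, Rmult_le_pos; lra.
Qed.

Lemma coef_f_mean (n : nat) : f n = binser_coef p n * beta_mean q d (fun t => t ^ n * 1).
Proof.
rewrite (beta_mean_pow q d n (fun _ => 1)) by auto using bounded_continuous_const.
pose proof (pos_INR n). rewrite beta_mean_1 by (auto; lra). unfold f. Rring.
Qed.

Lemma reexpansion_coef_le (N n : nat) : sum_n (fun k => g k * pascal_coef k n) N <= f n.
Proof.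
rewrite coef_f_mean, <- beta_mean_scal; auto.
2: { apply (bounded_continuous_mult (fun t => t ^ n)), bounded_continuous_const.
     apply (bounded_continuous_pow (fun t => t)), bounded_continuous_id. }
assert (Hbc : forall k, bounded_continuous (fun t => pascal_coef k n * phi k t)).
{ intros k. apply bounded_continuous_scal, bounded_continuous_phi. }
rewrite (sum_n_ext _ (fun k => beta_mean q d (fun t => pascal_coef k n * phi k t))).
2: { intros k. rewrite beta_mean_scal by auto using bounded_continuous_phi.
     unfold g. apply Rmult_comm. }
rewrite <- (beta_mean_sum_n q d Hq Hd (fun k t => pascal_coef k n * phi k t)) by auto.
apply beta_mean_le; auto.
- now apply (bounded_continuous_sum_n (fun k t => pascal_coef k n * phi k t)).
- apply bounded_continuous_scal, (bounded_continuous_mult (fun t => t ^ n)), bounded_continuous_const.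
  apply (bounded_continuous_pow (fun t => t)), bounded_continuous_id.
- intros t Ht.
  assert (Hi : 0 < / (1 + t)) by (apply Rinv_0_lt_compat; lra).
  assert (Hi1 : (1 + t) * / (1 + t) = 1) by (apply Rinv_r; lra).
  set (s := t / (1 + t)).
  assert (Hs : 0 <= s < 1).
  { unfold s, Rdiv. split; [apply Rmult_le_pos; lra|].
    apply Rlt_le_trans with ((1 + t) * / (1 + t)); [apply Rmult_lt_compat_r|]; lra. }
  pose proof (binser_reexpansion_le p s N n Hp Hs) as H.
  assert (Es : 1 - s = / (1 + t)) by (unfold s; field; lra).
  pose proof (Rpower_pos (1 + t) (- p)) as Hpp.
  rewrite (sum_n_ext _ (fun k => Rpower (1 + t) (- p) * (binser_coef p k * s ^ k * pascal_coef k n))).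
  2: { intros k. unfold phi. fold s. Rring. }
  rewrite sum_n_Rmult_l.
  apply Rle_trans with (Rpower (1 + t) (- p) *
     (binser_coef p n * s ^ n * Rpower (1 - s) (- (p + INR n)))).
  { apply Rmult_le_compat_l; lra. }
  right. rewrite Es.
  replace (Rpower (/ (1 + t)) (- (p + INR n))) with (Rpower (1 + t) p * (1 + t) ^ n).
  2: { rewrite <- Rpower_pow, <- Rpower_plus by lra.
       replace (/ (1 + t)) with (Rpower (1 + t) (- 1)).
       - rewrite Rpower_mult. f_equal. Rring.
       - replace (-1) with (Ropp 1) by Rring. rewrite Rpower_Ropp, Rpower_1; lra. }
  rewrite Rpower_Ropp. pose proof (Rpower_pos (1 + t) p).
  replace (t ^ n) with (s ^ n * (1 + t) ^ n).
  2: { rewrite <- Rpow_mult_distr. f_equal. unfold s. field. lra. }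
  field. lra.
Qed.

Lemma is_series_f_real (r : R) : 0 <= r < 1 ->
  is_series (fun n => f n * r ^ n) (beta_mean q d (fun t => Rpower (1 - r * t) (- p))).
Proof.
intros Hr.
assert (Hbc : forall n, bounded_continuous (fun t => binser_coef p n * r ^ n * (t ^ n * 1))).
{ intros n. apply bounded_continuous_scal, (bounded_continuous_mult (fun t => t ^ n)), bounded_continuous_const.
  apply (bounded_continuous_pow (fun t => t)), bounded_continuous_id. }
eapply is_series_ext.
2: { apply (beta_mean_series q d Hq Hd (fun n t => binser_coef p n * r ^ n * (t ^ n * 1)))
       with (M := fun n => binser_coef p n * r ^ n) (S := Rpower (1 - r) (- p)); auto.
     - apply (bounded_continuous_Rpower_neg (fun t => 1 - r * t) (1 - r)); try lra.
       + intros t Ht. apply (ex_derive_continuous (V := R_NormedModule)). now auto_derive.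
       + intros t Ht. assert (r * t <= r * 1) by (apply Rmult_le_compat_l; lra). lra.
     - intros k t Ht. assert (0 <= t ^ k <= 1).
       { split; [apply pow_le; lra|]. rewrite <- (pow1 k). apply pow_incr. lra. }
       pose proof (binser_coef_pos p k Hp). pose proof (pow_le r k (proj1 Hr)).
       assert (0 <= binser_coef p k * r ^ k) by (apply Rmult_le_pos; lra).
       rewrite Rabs_right.
       + rewrite <- (Rmult_1_r (binser_coef p k * r ^ k)) at 2.
         apply Rmult_le_compat_l; lra.
       + apply Rle_ge, Rmult_le_pos; lra.
     - apply binomial_series; auto. rewrite Rabs_right; lra.
     - intros t Ht. eapply is_series_ext.
       2: { apply (binomial_series p (r * t)); auto.
            assert (0 <= r * t) by (apply Rmult_le_pos; lra).
            assert (r * t <= r * 1) by (apply Rmult_le_compat_l; lra).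
            rewrite Rabs_right; lra. }
       intros n. simpl. rewrite Rpow_mult_distr. Rring. }
intros n. simpl. rewrite beta_mean_scal; auto.
- rewrite coef_f_mean. Rring.
- apply (bounded_continuous_mult (fun t => t ^ n)), bounded_continuous_const.
  apply (bounded_continuous_pow (fun t => t)), bounded_continuous_id.
Qed.

Lemma is_series_g_real (r : R) : 0 <= r < 1 ->
  is_series (fun k => g k * (1 + r) ^ k) (beta_mean q d (fun t => Rpower (1 - r * t) (- p))).
Proof.
intros Hr.
assert (Hbc : forall n, bounded_continuous (fun t => (1 + r) ^ n * phi n t)).
{ intros n. apply bounded_continuous_scal, bounded_continuous_phi. }
assert (Hs : forall t, 0 < t < 1 -> 0 <= (1 + r) * (t / (1 + t)) <= (1 + r) / 2 /\
   (1 + r) / 2 < 1).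
{ intros t Ht.
  assert (Hi : 0 < / (1 + t)) by (apply Rinv_0_lt_compat; lra).
  assert (t / (1 + t) <= / 2).
  { apply Rmult_le_reg_r with (1 + t); [lra|]. unfold Rdiv.
    rewrite Rmult_assoc, Rinv_l by lra. lra. }
  assert (0 <= t / (1 + t)) by (apply Rmult_le_pos; lra).
  repeat split; [apply Rmult_le_pos; lra| |lra].
  apply Rmult_le_compat_l; lra. }
eapply is_series_ext.
2: { apply (beta_mean_series q d Hq Hd (fun n t => (1 + r) ^ n * phi n t))
       with (M := fun n => binser_coef p n * ((1 + r) / 2) ^ n)
         (S := Rpower (1 - (1 + r) / 2) (- p)); auto.
     - apply (bounded_continuous_Rpower_neg (fun t => 1 - r * t) (1 - r)); try lra.
       + intros t Ht. apply (ex_derive_continuous (V := R_NormedModule)). now auto_derive.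
       + intros t Ht. assert (r * t <= r * 1) by (apply Rmult_le_compat_l; lra). lra.
     - intros k t Ht. destruct (Hs t Ht) as [H1 H2].
       pose proof (binser_coef_pos p k Hp).
       replace ((1 + r) ^ k * phi k t) with
         (binser_coef p k * ((1 + r) * (t / (1 + t))) ^ k * Rpower (1 + t) (- p)).
       2: { unfold phi. rewrite (Rpow_mult_distr (1 + r)). Rring. }
       pose proof (pow_le _ k (proj1 H1)) as H3. pose proof (pow_incr _ _ k H1) as H4.
       pose proof (Rpower_pos (1 + t) (- p)).
       assert (Rpower (1 + t) (- p) <= 1).
       { apply Rle_trans with (Rpower 1 (- p)). apply Rpower_neg_le; lra.
         unfold Rpower. rewrite ln_1, Rmult_0_r, exp_0. lra. }
       rewrite Rabs_right.
       + rewrite <- (Rmult_1_r (binser_coef p k * ((1 + r) / 2) ^ k)).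
         apply Rmult_le_compat; try lra.
         * apply Rmult_le_pos; lra.
         * apply Rmult_le_compat_l; lra.
       + apply Rle_ge, Rmult_le_pos; [apply Rmult_le_pos|]; lra.
     - apply binomial_series; auto. rewrite Rabs_right; lra.
     - intros t Ht. destruct (Hs t Ht) as [H1 H2].
       assert (0 <= r * t) by (apply Rmult_le_pos; lra).
       assert (r * t <= r * 1) by (apply Rmult_le_compat_l; lra).
       replace (Rpower (1 - r * t) (- p)) with
         (Rpower (1 + t) (- p) * Rpower (1 - (1 + r) * (t / (1 + t))) (- p)).
       + eapply is_series_ext.
         2: { apply is_series_scal_R. apply (binomial_series p ((1 + r) * (t / (1 + t)))); auto.
              rewrite Rabs_right; lra. }
         intros n. unfold phi. rewrite (Rpow_mult_distr (1 + r)). Rring.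
       + rewrite Rpower_mult_distr by lra. f_equal. field. lra. }
intros n. simpl. rewrite beta_mean_scal by auto using bounded_continuous_phi.
apply Rmult_comm.
Qed.

Lemma CV_radius_g : Rbar_le 2 (CV_radius (fun n => Cmod (RtoC (g n)))).
Proof.
apply Rbar_le_CV_radius. intros x Hx.
assert (Hbd : exists M, forall n, Rabs (g n * (1 + Rmax 0 (x - 1)) ^ n) <= M).
{ assert (H : 0 <= Rmax 0 (x - 1) < 1).
  { split; [apply Rmax_l|]. apply Rmax_lub_lt; lra. }
  pose proof (is_series_g_real _ H) as HS.
  apply ex_intro with (beta_mean q d (fun t => Rpower (1 - Rmax 0 (x - 1) * t) (- p))).
  assert (Hg0 : forall n, 0 <= g n).
  { intros n. unfold g. rewrite <- (beta_mean_const q d Hq Hd 0).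
    apply beta_mean_le; auto using bounded_continuous_const, bounded_continuous_phi.
    intros t Ht. assert (0 < / (1 + t)) by (apply Rinv_0_lt_compat; lra).
    apply Rmult_le_pos; [|apply Rlt_le, Rpower_pos].
    apply Rmult_le_pos; [now apply Rlt_le, binser_coef_pos|].
    apply pow_le, Rmult_le_pos; lra. }
  assert (Hpos : forall n, 0 <= g n * (1 + Rmax 0 (x - 1)) ^ n).
  { intros n. apply Rmult_le_pos; auto. apply pow_le. lra. }
  intros n. rewrite Rabs_right by apply Rle_ge, Hpos.
  apply Rle_trans with (2 := sum_n_le_series _ _ n Hpos HS).
  destruct n as [|n]; [rewrite sum_O; lra|]. rewrite sum_Sn. unfold plus; simpl plus.
  rewrite <- (Rplus_0_l (g (S n) * _)) at 1. apply Rplus_le_compat_r.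
  clear -Hpos. induction n as [|n IH]; [rewrite sum_O; auto|].
  rewrite sum_Sn. now apply Rplus_le_le_0_compat. }
destruct Hbd as [M HM]. exists M. intros n. apply Rle_trans with (2 := HM n).
rewrite Cmod_R, !Rabs_mult, Rabs_Rabsolu. apply Rmult_le_compat_l; [apply Rabs_pos|].
rewrite <- !RPow_abs. apply pow_incr. split; [apply Rabs_pos|].
pose proof (Rmax_l 0 (x - 1)). pose proof (Rmax_r 0 (x - 1)).
rewrite !Rabs_right; lra.
Qed.

Lemma hyp2F1_minus_one :
  hyp2F1 (RtoC p) (RtoC q) (RtoC (q + d)) (RtoC (-1)) =
  RtoC (beta_mean q d (fun t => Rpower (1 + t) (- p))).
Proof.
assert (HC : continues_to (pFq [RtoC p; RtoC q] [RtoC (q + d)]) (RtoC (-1))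
   (RtoC (beta_mean q d (fun t => Rpower (1 + t) (- p))))).
{ exists 2, (fun z => CPS (fun n => RtoC (g n)) (z - -1)).
  split; [lra|]. split; [|split].
  - intros z Hz. eexists. apply is_derive_CPS.
    apply Rbar_lt_le_trans with (2 := CV_radius_g). exact Hz.
  - intros z Hz Hu. symmetry. apply CPS_unique.
    apply is_Cpseries_Cpow.
    apply (is_series_ext (fun n => (RtoC (f n) * Cpow z n)%C)).
    { intros n. now rewrite pFq_coef_2F1 by lra. }
    assert (Hu' : 0 <= Cmod z < 1) by (split; [apply Cmod_ge_0|exact Hu]).
    apply (reexpansion f g).
    + apply reexpansion_coef_le.
    + eexists; split; [now apply is_series_f_real|now apply is_series_g_real].
    + replace (1 + z)%C with (z - -1)%C by ring.
      apply (proj1 (is_Cpseries_Cpow (fun n => RtoC (g n)) _ _)).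
      apply ex_Cpseries. apply Rbar_lt_le_trans with (2 := CV_radius_g). exact Hz.
  - replace (-1 - -1)%C with (RtoC 0) by ring.
    apply CPS_unique.
    replace (RtoC (beta_mean q d (fun t => Rpower (1 + t) (- p)))) with (RtoC (g 0)).
    + apply (is_pseries_0 (K := C_AbsRing) (V := C_NormedModule)).
    + apply (f_equal RtoC), (beta_mean_ext q d Hq Hd (phi 0));
        [apply bounded_continuous_phi|].
      intros t Ht. unfold phi, binser_coef. simpl. field. }
apply (iota_unique (V := C_CompleteNormedModule)); auto.
intros y Hy. now apply (continues_to_unique (pFq [RtoC p; RtoC q] [RtoC (q + d)])).
Qed.

End Hyp2F1.

(** * Bounds on the partial sums of the majorant series *)

Lemma is_series_of_RtoC (a : nat -> R) (l : R) :
  is_Cseries (fun n => RtoC (a n)) (RtoC l) -> is_series a l.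
Proof.
intros H P [eps HP].
assert (HL : locally (RtoC l : C_NormedModule) (fun z : C => P (fst z))).
{ exists eps. intros z [Hz _]. apply HP. exact Hz. }
generalize (H _ HL). unfold filtermap. apply filter_imp. intros n Hn.
rewrite csum_RtoC in Hn. exact Hn.
Qed.

Lemma PSeries_abel_1 (a : nat -> R) (l : R) : is_series a l ->
  filterlim (PSeries a) (at_left 1) (locally l).
Proof.
intros Ha.
assert (E1 : is_pseries a 1 l).
{ apply is_pseries_R. eapply is_series_ext; [|exact Ha].
  intros n. rewrite pow1. Rring. }
assert (Hr : Rbar_le 1 (CV_radius a)).
{ destruct (Rbar_le_dec 1 (CV_radius a)) as [H|H]; auto. exfalso.
  apply Rbar_not_le_lt in H.
  apply (CV_disk_outside a 1); [now rewrite Rabs_R1|].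
  apply ex_series_lim_0. exists l. now apply is_pseries_R. }
rewrite <- (is_pseries_unique _ _ _ E1).
destruct (Rbar_le_lt_or_eq_dec _ _ Hr) as [H|H].
- assert (HC : continuous (PSeries a) 1).
  { apply continuity_pt_filterlim, PSeries_continuity. now rewrite Rabs_R1. }
  eapply filterlim_filter_le_1; [|exact HC]. apply filter_le_within.
- pose proof (Abel a) as HA. rewrite <- H in HA. apply HA; simpl; auto; try lra.
  now exists l.
Qed.

Section MainInequality.
Variables alpha beta d : R.
Hypotheses (Ha : 0 < alpha) (Hb : 0 < beta) (Hd : 0 < d).

Let psi (t : R) : R := Rpower (1 + t) (- alpha).

Lemma bounded_continuous_psi : bounded_continuous psi.
Proof. apply bounded_continuous_1p_neg. lra. Qed.

Lemma bounded_continuous_1p_sq (r : R) : 0 <= r ->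
  bounded_continuous (fun t => Rpower (1 + r * t ^ 2) (- alpha)).
Proof.
intros Hr.
apply (bounded_continuous_Rpower_neg (fun t => 1 + r * t ^ 2) 1); try lra.
- intros t _. apply (ex_derive_continuous (V := R_NormedModule)). now auto_derive.
- intros t Ht. assert (0 <= r * t ^ 2) by (apply Rmult_le_pos, pow_le; lra). lra.
Qed.

Lemma bounded_continuous_pow_psi (n : nat) : bounded_continuous (fun t => t ^ n * psi t).
Proof.
apply (bounded_continuous_mult (fun t => t ^ n)), bounded_continuous_psi.
apply (bounded_continuous_pow (fun t => t)), bounded_continuous_id.
Qed.

Lemma gamma_2F1_term_mean (n : nat) :
  gamma_2F1_term alpha beta (beta + d) n =
  RtoC (Gamma beta / Gamma (beta + d) *
    ((-1) ^ n * binser_coef alpha n * beta_mean beta d (fun t => t ^ (2 * n) * psi t))).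
Proof.
unfold gamma_2F1_term, gbinom.
replace (beta + d + 2 * INR n) with (beta + 2 * INR n + d) by ring.
pose proof (pos_INR n) as Hn.
rewrite hyp2F1_minus_one by lra. rewrite <- RtoC_mult. apply (f_equal RtoC).
rewrite beta_mean_pow by auto using bounded_continuous_psi.
replace (beta + 2 * INR n + d) with (beta + d + 2 * INR n) by ring.
replace (2 * INR n) with (INR (2 * n)) by now rewrite mult_INR.
rewrite !Gamma_poch by lra. rewrite Ropp_involutive. unfold binser_coef. fold psi.
pose proof (Gamma_pos (beta + d) ltac:(lra)).
pose proof (pochR_pos (beta + d) (2 * n) ltac:(lra)).
pose proof (INR_fact_lt_0 n).
field. lra.
Qed.

Lemma alternating_mean_series (r : R) : 0 <= r < 1 ->
  is_series (fun n => (-1) ^ n * binser_coef alpha n *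
      beta_mean beta d (fun t => t ^ (2 * n) * psi t) * r ^ n)
    (beta_mean beta d (fun t => psi t * Rpower (1 + r * t ^ 2) (- alpha))).
Proof.
intros Hr.
assert (Hbc : forall n, bounded_continuous
  (fun t => (-1) ^ n * binser_coef alpha n * r ^ n * (t ^ (2 * n) * psi t))).
{ intros n. apply bounded_continuous_scal, bounded_continuous_pow_psi. }
eapply is_series_ext.
2: { apply (beta_mean_series beta d Hb Hd
       (fun n t => (-1) ^ n * binser_coef alpha n * r ^ n * (t ^ (2 * n) * psi t)))
       with (M := fun n => binser_coef alpha n * r ^ n) (S := Rpower (1 - r) (- alpha)); auto.
     - apply (bounded_continuous_mult psi); [apply bounded_continuous_psi|].
       apply bounded_continuous_1p_sq. lra.
     - intros k t Ht.
       pose proof (binser_coef_pos alpha k Ha). pose proof (pow_le r k (proj1 Hr)).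
       assert (0 <= t ^ (2 * k) <= 1).
       { split; [apply pow_le; lra|]. rewrite <- (pow1 (2 * k)). apply pow_incr. lra. }
       assert (0 <= psi t <= 1).
       { split; [apply Rlt_le, Rpower_pos|].
         apply Rle_trans with (Rpower 1 (- alpha)). apply Rpower_neg_le; lra.
         unfold Rpower. rewrite ln_1, Rmult_0_r, exp_0. lra. }
       rewrite !Rabs_mult, pow_1_abs, Rmult_1_l.
       rewrite (Rabs_right (binser_coef _ _)), (Rabs_right (r ^ k)),
         (Rabs_right (t ^ _)), (Rabs_right (psi t)) by lra.
       rewrite <- (Rmult_1_r (binser_coef alpha k * r ^ k)) at 2.
       apply Rmult_le_compat_l; [apply Rmult_le_pos; lra|].
       rewrite <- (Rmult_1_r 1). apply Rmult_le_compat; lra.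
     - apply binomial_series; auto. rewrite Rabs_right; lra.
     - intros t Ht.
       assert (0 <= t ^ 2 <= 1).
       { split; [apply pow_le; lra|]. rewrite <- (pow1 2). apply pow_incr. lra. }
       assert (0 <= r * t ^ 2) by (apply Rmult_le_pos; lra).
       assert (r * t ^ 2 <= r * 1) by (apply Rmult_le_compat_l; lra).
       replace (1 + r * t ^ 2) with (1 - - (r * t ^ 2)) by ring.
       eapply is_series_ext.
       2: { apply is_series_scal_R. apply (binomial_series alpha (- (r * t ^ 2))); auto.
            rewrite Rabs_Ropp, Rabs_right; lra. }
       intros n. cbv beta. replace (- (r * t ^ 2)) with (-1 * (r * t ^ 2)) by ring.
       rewrite !Rpow_mult_distr, <- pow_mult. Rring. }
intros n. cbv beta. rewrite beta_mean_scal by auto using bounded_continuous_pow_psi. Rring.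
Qed.

(* Abel's theorem is needed: the expansion of [(1 + t^2)^(-alpha)] under the integral
   need not converge absolutely. *)
Lemma alternating_mean_lower_bound (l : R) :
  is_series (fun n => (-1) ^ n * binser_coef alpha n *
      beta_mean beta d (fun t => t ^ (2 * n) * psi t)) l ->
  beta_mean beta d (fun t => psi t * Rpower (1 + 1 * t ^ 2) (- alpha)) <= l.
Proof.
intros Hl. set (Lam := beta_mean beta d _).
assert (H : Rbar_le Lam l); [|exact H].
apply (filterlim_le (F := at_left 1) (fun _ => Lam) (PSeries (fun n => (-1) ^ n * binser_coef alpha n *
      beta_mean beta d (fun t => t ^ (2 * n) * psi t)))).
3: now apply PSeries_abel_1.
2: apply filterlim_const.
exists (mkposreal 1 Rlt_0_1). intros r Hr Hr1.
change (Rabs (r - 1) < 1) in Hr. apply Rabs_def2 in Hr.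
pose proof (alternating_mean_series r ltac:(lra)) as HS.
apply is_pseries_R, is_pseries_unique in HS. rewrite HS.
apply beta_mean_le; auto.
- apply (bounded_continuous_mult psi); [apply bounded_continuous_psi|].
  apply bounded_continuous_1p_sq. lra.
- apply (bounded_continuous_mult psi); [apply bounded_continuous_psi|].
  apply bounded_continuous_1p_sq. lra.
- intros t Ht. apply Rmult_le_compat_l; [apply Rlt_le, Rpower_pos|].
  assert (0 <= t ^ 2) by (apply pow_le; lra).
  assert (0 <= r * t ^ 2) by (apply Rmult_le_pos; lra).
  assert (r * t ^ 2 <= 1 * t ^ 2) by (apply Rmult_le_compat_r; lra).
  apply Rpower_neg_le; lra.
Qed.

Lemma partial_sum_upper_bound (N : nat) :
  Gamma (d + alpha) * Gamma (beta + d) / (Gamma d * Gamma (beta + (d + alpha))) *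
  sum_n (fun n => binser_coef alpha n *
    (pochR beta (4 * n) / pochR (alpha + beta + d) (4 * n))) N <=
  beta_mean beta d (fun t => psi t * Rpower (1 + 1 * t ^ 2) (- alpha)).
Proof.
assert (Hp : forall n, bounded_continuous (fun t => t ^ (4 * n) * 1)).
{ intros n. apply (bounded_continuous_mult (fun t => t ^ (4 * n))), bounded_continuous_const.
  apply (bounded_continuous_pow (fun t => t)), bounded_continuous_id. }
assert (Hp' : forall n, bounded_continuous (fun t => binser_coef alpha n * (t ^ (4 * n) * 1))).
{ intros n. now apply bounded_continuous_scal. }
assert (Hps := bounded_continuous_sum_n
  (fun n t => binser_coef alpha n * (t ^ (4 * n) * 1)) N Hp').
cbv beta in Hps.
assert (Hda : 0 < d + alpha) by lra.
rewrite (sum_n_ext _ (fun n => beta_mean beta (d + alpha)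
   (fun t => binser_coef alpha n * (t ^ (4 * n) * 1)))).
2: { intros n. rewrite beta_mean_scal by auto.
     rewrite (beta_mean_pow beta (d + alpha) (4 * n) (fun _ => 1)) by
       auto using bounded_continuous_const.
     pose proof (pos_INR (4 * n)). rewrite beta_mean_1 by lra.
     replace (alpha + beta + d) with (beta + (d + alpha)) by ring. Rring. }
rewrite <- (beta_mean_sum_n beta (d + alpha) Hb Hda
  (fun n t => binser_coef alpha n * (t ^ (4 * n) * 1))) by auto.
rewrite <- beta_mean_shift_r by (auto; lra).
apply beta_mean_le; auto.
- apply (bounded_continuous_mult (fun t => Rpower (1 - t) alpha)); auto.
  apply bounded_continuous_Rpower_1m. lra.
- apply (bounded_continuous_mult psi); [apply bounded_continuous_psi|].
  apply bounded_continuous_1p_sq. lra.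
- intros t Ht.
  assert (H4 : 0 <= t ^ 4 < 1).
  { split; [apply pow_le; lra|].
    replace (t ^ 4) with (t * (t * (t * t))) by ring.
    assert (t * t < 1) by nra. assert (t * (t * t) < 1) by nra. nra. }
  assert (H2 : 0 <= t ^ 2) by (apply pow_le; lra).
  assert (HS : is_series (fun n => binser_coef alpha n * (t ^ (4 * n) * 1))
    (Rpower (1 - t ^ 4) (- alpha))).
  { eapply is_series_ext; [|apply binomial_series; auto; rewrite Rabs_right; lra].
    intros n. cbv beta. rewrite <- pow_mult. Rring. }
  apply Rle_trans with (Rpower (1 - t) alpha * Rpower (1 - t ^ 4) (- alpha)).
  + apply Rmult_le_compat_l; [apply Rlt_le, Rpower_pos|].
    apply sum_n_le_series; auto. intros k.
    apply Rmult_le_pos; [now apply Rlt_le, binser_coef_pos|].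
    rewrite Rmult_1_r. apply pow_le. lra.
  + right. unfold psi. rewrite Rpower_mult_distr by lra.
    replace (1 - t ^ 4) with ((1 - t) * ((1 + t) * (1 + 1 * t ^ 2))) by ring.
    rewrite <- Rpower_mult_distr by (try apply Rmult_lt_0_compat; lra).
    rewrite <- Rmult_assoc, <- Rpower_plus, Rplus_opp_r, Rpower_O by lra. ring.
Qed.

Lemma partial_sum_le_prefactor (S : R) (N : nat) :
  is_Cseries (gamma_2F1_term alpha beta (beta + d)) (RtoC S) ->
  sum_n (fun n => binser_coef alpha n *
    (pochR beta (4 * n) / pochR (alpha + beta + d) (4 * n))) N <=
  Gamma (alpha + beta + d) * Gamma d / (Gamma beta * Gamma (alpha + d)) * S.
Proof.
intros HS.
pose proof (Gamma_pos beta Hb) as G1. pose proof (Gamma_pos d Hd) as G2.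
pose proof (Gamma_pos (beta + d) ltac:(lra)) as G3.
pose proof (Gamma_pos (alpha + d) ltac:(lra)) as G4.
pose proof (Gamma_pos (alpha + beta + d) ltac:(lra)) as G5.
set (kappa := Gamma beta / Gamma (beta + d)).
assert (Hk : 0 < kappa) by now apply Rdiv_lt_0_compat.
assert (HS' : is_series (fun n => (-1) ^ n * binser_coef alpha n *
      beta_mean beta d (fun t => t ^ (2 * n) * psi t)) (/ kappa * S)).
{ eapply is_series_ext.
  2: { apply is_series_scal_R. apply is_series_of_RtoC.
       eapply is_series_ext; [|exact HS]. intros n. apply gamma_2F1_term_mean. }
  intros n. cbv beta. fold kappa. rewrite <- Rmult_assoc, Rinv_l by lra. Rring. }
pose proof (alternating_mean_lower_bound _ HS') as H1.
pose proof (partial_sum_upper_bound N) as H2.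
set (X := sum_n _ N) in *.
replace (beta + (d + alpha)) with (alpha + beta + d) in H2 by ring.
replace (d + alpha) with (alpha + d) in H2 by ring.
set (K := Gamma (alpha + d) * Gamma (beta + d) / (Gamma d * Gamma (alpha + beta + d))) in *.
assert (HK : 0 < K) by (apply Rdiv_lt_0_compat; apply Rmult_lt_0_compat; auto).
apply Rmult_le_reg_l with K; auto.
apply Rle_trans with (/ kappa * S); [lra|].
right. unfold K, kappa. field. lra.
Qed.

End MainInequality.

(** * A coefficient condition for uniform convexity *)

Lemma ex_series_of_bounded (a : nat -> R) (M : R) : (forall n, 0 <= a n) ->
  (forall N, sum_n a N <= M) -> exists l, is_series a l /\ l <= M.
Proof.
intros Ha HM.
destruct (ex_finite_lim_seq_incr (sum_n a) M) as [l Hl]; auto.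
- intros n. rewrite sum_Sn. change plus with Rplus. generalize (Ha (S n)). lra.
- exists l. split; [exact Hl|].
  assert (H : Rbar_le l M); [|exact H].
  apply (is_lim_seq_le (sum_n a) (fun _ => M)); auto. apply is_lim_seq_const.
Qed.

Lemma is_series_le_R (a b : nat -> R) (la lb : R) : (forall n, a n <= b n) ->
  is_series a la -> is_series b lb -> la <= lb.
Proof.
intros H Ha Hb. assert (HL : Rbar_le la lb); [|exact HL].
apply (is_lim_seq_le (sum_n a) (sum_n b)); auto.
intros n. induction n as [|n IH]; [now rewrite !sum_O|].
rewrite !sum_Sn. now apply Rplus_le_compat.
Qed.

Lemma Cmod_pow_diff_le (z w : C) (n : nat) : Cmod z <= 1 -> Cmod w <= 1 ->
  Cmod (Cpow z n - Cpow w n) <= INR n * Cmod (z - w).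
Proof.
intros Hz Hw. induction n as [|n IH].
- simpl. replace (1 - 1)%C with (RtoC 0) by ring. rewrite Cmod_0. lra.
- replace (Cpow z (S n) - Cpow w (S n))%C with
    (z * (Cpow z n - Cpow w n) + (z - w) * Cpow w n)%C by (simpl; ring).
  rewrite S_INR, Rmult_plus_distr_r, Rmult_1_l.
  apply Rle_trans with (1 := Cmod_triangle _ _). rewrite !Cmod_mult, Cmod_pow.
  apply Rplus_le_compat.
  + rewrite <- (Rmult_1_l (INR n * _)). apply Rmult_le_compat; auto using Cmod_ge_0.
  + rewrite <- (Rmult_1_r (Cmod (z - w))) at 2.
    apply Rmult_le_compat_l; [apply Cmod_ge_0|].
    rewrite <- (pow1 n). apply pow_incr. split; auto. apply Cmod_ge_0.
Qed.

Lemma is_Cseries_drop (a : nat -> C) (l : C) :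
  is_Cseries a l -> is_Cseries (fun n => a (S n)) (l - a 0%nat)%C.
Proof.
intros H. apply is_series_incr_1.
match goal with |- is_series _ ?x => replace x with l end; auto.
change (l = l - a 0%nat + a 0%nat)%C. ring.
Qed.

Lemma is_derive_on_disc (f : C -> C) (u : nat -> C) (z : C) :
  Rbar_le 1 (CV_radius (fun n => Cmod (u n))) ->
  (forall w, Cmod w < 1 -> f w = CPS u w) -> Cmod z < 1 ->
  is_Cderive f z (CPS (CPS_derive u) z).
Proof.
intros Hu Hf Hz.
apply is_derive_ext_loc with (CPS u).
- assert (He : 0 < 1 - Cmod z) by lra.
  exists (mkposreal _ He). intros w Hw.
  change (Cmod (w - z) < 1 - Cmod z) in Hw. symmetry. apply Hf.
  replace w with ((w - z) + z)%C by ring.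
  apply Rle_lt_trans with (1 := Cmod_triangle _ _). lra.
- apply is_derive_CPS_0. apply Rbar_lt_le_trans with (2 := Hu). exact Hz.
Qed.

Lemma Rbar_le_1_CV_radius (a : nat -> R) (M : R) : (forall n, Rabs (a n) <= M) ->
  Rbar_le 1 (CV_radius a).
Proof.
intros H. apply Rbar_le_CV_radius. intros x Hx. exists M. intros n.
rewrite Rabs_mult, <- (Rmult_1_r M).
apply Rmult_le_compat; auto using Rabs_pos.
rewrite <- RPow_abs, Rabs_right by lra. rewrite <- (pow1 n). apply pow_incr. lra.
Qed.

(* [2 (n+2) (n+1) + (n+2) = (n+2) (2 (n+2) - 1)]: with [m1] and [m2] the sums of
   [k |u k|] and [k (k-1) |u k|] over [k >= 2], the hypothesis reads [2 m2 + m1 <= 1],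
   so that [|z - zeta| |f''| < 2 m2 <= 1 - m1 <= |f'|]. *)
Lemma UCV_of_coefficients (f : C -> C) (u : nat -> C) :
  u 0%nat = RtoC 0 -> u 1%nat = RtoC 1 ->
  (forall z, Cmod z < 1 -> is_Cpseries u z (f z)) ->
  (forall N, sum_n (fun n => (INR n + 2) * (2 * INR n + 3) * Cmod (u (S (S n)))) N <= 1) ->
  class_UCV f.
Proof.
intros Hu0 Hu1 Hf Hsum.
assert (Hpos : forall n, 0 <= INR n /\ 0 <= Cmod (u (S (S n)))).
{ intros n; split; [apply pos_INR|apply Cmod_ge_0]. }
assert (Hm1 : exists m1, is_series (fun n => (INR n + 2) * Cmod (u (S (S n)))) m1 /\ m1 <= 1).
{ apply ex_series_of_bounded.
  - intros n. destruct (Hpos n). apply Rmult_le_pos; lra.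
  - intros N. apply Rle_trans with (2 := Hsum N). apply sum_n_m_le.
    intros n. destruct (Hpos n). apply Rmult_le_compat_r; nra. }
assert (Hm2 : exists m2, is_series (fun n => (INR n + 1) * (INR n + 2) * Cmod (u (S (S n)))) m2 /\ m2 <= 1).
{ apply ex_series_of_bounded.
  - intros n. destruct (Hpos n). apply Rmult_le_pos; nra.
  - intros N. apply Rle_trans with (2 := Hsum N). apply sum_n_m_le.
    intros n. destruct (Hpos n). apply Rmult_le_compat_r; nra. }
destruct Hm1 as [m1 [Hm1 _]]. destruct Hm2 as [m2 [Hm2 _]].
assert (Hm12 : m1 <= m2).
{ apply (is_series_le_R _ _ _ _) with (2 := Hm1) (3 := Hm2).
  intros n. destruct (Hpos n). apply Rmult_le_compat_r; nra. }
assert (Hmm : 2 * m2 + m1 <= 1).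
{ destruct (ex_series_of_bounded _ _ (fun n => Rmult_le_pos _ _
    (ltac:(destruct (Hpos n); nra) : 0 <= (INR n + 2) * (2 * INR n + 3)) (proj2 (Hpos n))) Hsum)
    as [T [HT HT1]].
  pose proof (is_series_plus _ _ _ _ (is_series_scal_R 2 _ _ Hm2) Hm1) as HP.
  apply Rle_trans with (2 := HT1).
  apply (is_series_le_R _ _ _ _) with (2 := HP) (3 := HT).
  intros n. right. unfold plus; simpl. ring. }
assert (Hm2_0 : 0 <= m2).
{ apply Rle_trans with (sum_n (fun n => (INR n + 1) * (INR n + 2) * Cmod (u (S (S n)))) 0).
  - rewrite sum_O. destruct (Hpos 0%nat). apply Rmult_le_pos; nra.
  - apply sum_n_le_series; auto. intros n. destruct (Hpos n). apply Rmult_le_pos; nra. }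
assert (Hubd : forall n, Rabs (Cmod (u n)) <= 1).
{ intros [|[|n]].
  - rewrite Hu0, Cmod_0, Rabs_R0. lra.
  - rewrite Hu1, Cmod_1, Rabs_R1. lra.
  - rewrite Rabs_right by apply Rle_ge, Cmod_ge_0.
    apply Rle_trans with (sum_n (fun n => (INR n + 2) * (2 * INR n + 3) * Cmod (u (S (S n)))) n); auto.
    assert (HN : forall k, 0 <= sum_n (fun n => (INR n + 2) * (2 * INR n + 3) * Cmod (u (S (S n)))) k).
    { intros k. induction k as [|k IH].
      - rewrite sum_O. destruct (Hpos 0%nat). apply Rmult_le_pos; nra.
      - rewrite sum_Sn. apply Rplus_le_le_0_compat; auto.
        destruct (Hpos (S k)). apply Rmult_le_pos; nra. }
    assert (HX : Cmod (u (S (S n))) <= (INR n + 2) * (2 * INR n + 3) * Cmod (u (S (S n)))).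
    { destruct (Hpos n). rewrite <- (Rmult_1_l (Cmod _)) at 1.
      apply Rmult_le_compat_r; nra. }
    destruct n as [|n]; [now rewrite sum_O|].
    rewrite sum_Sn. change plus with Rplus. generalize (HN n). cbv beta. lra. }
pose proof (Rbar_le_1_CV_radius _ _ Hubd) as HCV.
assert (HCV' : Rbar_le 1 (CV_radius (fun n => Cmod (CPS_derive u n)))).
{ now rewrite CV_radius_CPS_derive. }
assert (HfC : forall w, Cmod w < 1 -> f w = CPS u w).
{ intros w Hw. symmetry. apply CPS_unique. auto. }
assert (HD1 : forall w, Cmod w < 1 -> is_Cderive f w (CPS (CPS_derive u) w)).
{ intros w Hw. now apply is_derive_on_disc. }
assert (HC1 : forall w, Cmod w < 1 -> C_derive f w = CPS (CPS_derive u) w).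
{ intros w Hw. now apply is_C_derive_unique, HD1. }
assert (HC2 : forall w, Cmod w < 1 -> C_derive (C_derive f) w = CPS (CPS_derive (CPS_derive u)) w).
{ intros w Hw. apply is_C_derive_unique. now apply is_derive_on_disc. }
split; [split; [split|]|].
- intros z Hz. eexists. now apply HD1.
- exists u. auto.
- intros z w Hz Hw Hzw. unfold unit_disc in *.
  pose proof (proj1 (is_Cpseries_Cpow _ _ _) (Hf z Hz)) as Sz.
  pose proof (proj1 (is_Cpseries_Cpow _ _ _) (Hf w Hw)) as Sw.
  pose proof (is_series_minus _ _ _ _ Sz Sw) as SD.
  apply is_Cseries_drop, is_Cseries_drop in SD.
  pose proof (is_series_scal_R (Cmod (z - w)) _ _ Hm1) as SB.
  assert (HB : Cmod (w - z) <= Cmod (z - w) * m1).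
  { replace (w - z)%C with (f z - f w - (u 0%nat * Cpow z 0 - u 0%nat * Cpow w 0)
       - (u 1%nat * Cpow z 1 - u 1%nat * Cpow w 1))%C.
    2: { rewrite Hzw, Hu0, Hu1. simpl Cpow. ring. }
    refine (Cmod_series_le _ _ _ _ _ SD SB). intros n.
    change (Cmod (u (S (S n)) * Cpow z (S (S n)) - u (S (S n)) * Cpow w (S (S n)))
       <= Cmod (z - w) * ((INR n + 2) * Cmod (u (S (S n))))).
    replace (u (S (S n)) * Cpow z (S (S n)) - u (S (S n)) * Cpow w (S (S n)))%C with
      (u (S (S n)) * (Cpow z (S (S n)) - Cpow w (S (S n))))%C by ring.
    rewrite Cmod_mult.
    pose proof (Cmod_pow_diff_le z w (S (S n)) ltac:(lra) ltac:(lra)) as H.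
    rewrite !S_INR in H. replace (INR n + 1 + 1) with (INR n + 2) in H by ring.
    pose proof (Rmult_le_compat_l _ _ _ (proj2 (Hpos n)) H) as H'. lra. }
  replace (w - z)%C with (- (z - w))%C in HB by ring. rewrite Cmod_opp in HB.
  assert (H0 : Cmod (z - w) = 0).
  { pose proof (Cmod_ge_0 (z - w)). nra. }
  apply Cmod_eq_0 in H0. replace z with ((z - w) + w)%C by ring. rewrite H0. ring.
- intros zeta z Hzeta Hz. unfold unit_disc in *.
  rewrite HC1, HC2 by auto.
  assert (E1 : is_Cpseries (CPS_derive u) z (CPS (CPS_derive u) z)).
  { apply ex_Cpseries. apply Rbar_lt_le_trans with (2 := HCV'). exact Hz. }
  assert (E2 : is_Cpseries (CPS_derive (CPS_derive u)) z (CPS (CPS_derive (CPS_derive u)) z)).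
  { apply ex_Cpseries. rewrite CV_radius_CPS_derive.
    apply Rbar_lt_le_trans with (2 := HCV'). exact Hz. }
  set (f1 := CPS (CPS_derive u) z) in *. set (f2 := CPS (CPS_derive (CPS_derive u)) z) in *.
  apply is_Cpseries_Cpow in E1. apply is_Cpseries_Cpow in E2.
  assert (Hpw : forall n, 0 <= Cmod z ^ n <= 1).
  { intros n. split; [apply pow_le, Cmod_ge_0|]. rewrite <- (pow1 n). apply pow_incr.
    split; [apply Cmod_ge_0|lra]. }
  assert (B2 : Cmod f2 <= m2).
  { refine (Cmod_series_le _ _ _ _ _ E2 Hm2). intros n. unfold CPS_derive.
    rewrite !Cmod_mult, Cmod_pow, !Cmod_R, !Rabs_right by apply Rle_ge, pos_INR.
    rewrite !S_INR. replace (INR n + 1 + 1) with (INR n + 2) by ring.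
    destruct (Hpos n). destruct (Hpw n).
    assert (0 <= (INR n + 1) * ((INR n + 2) * Cmod (u (S (S n))))).
    { apply Rmult_le_pos; [lra|apply Rmult_le_pos; lra]. }
    rewrite (Rmult_assoc (INR n + 1) (INR n + 2)). nra. }
  assert (B1 : Cmod (f1 - 1) <= m1).
  { apply is_Cseries_drop in E1.
    replace (f1 - 1)%C with (f1 - CPS_derive u 0 * Cpow z 0)%C.
    2: { unfold CPS_derive. rewrite Hu1. simpl. ring. }
    refine (Cmod_series_le _ _ _ _ _ E1 Hm1). intros n. unfold CPS_derive.
    rewrite !Cmod_mult, Cmod_pow, !Cmod_R, !Rabs_right by apply Rle_ge, pos_INR.
    rewrite !S_INR. replace (INR n + 1 + 1) with (INR n + 2) by ring.
    destruct (Hpos n). destruct (Hpw (S n)).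
    assert (0 <= (INR n + 2) * Cmod (u (S (S n)))) by (apply Rmult_le_pos; lra).
    nra. }
  assert (B0 : 1 - m1 <= Cmod f1).
  { pose proof (Cmod_triangle f1 (- (f1 - 1))) as H. rewrite Cmod_opp in H.
    replace (f1 + - (f1 - 1))%C with (RtoC 1) in H by ring. rewrite Cmod_1 in H. lra. }
  assert (Hzz : Cmod (z - zeta) < 2).
  { pose proof (Cmod_triangle z (- zeta)) as H. rewrite Cmod_opp in H.
    unfold Cminus. lra. }
  assert (Hf1 : 0 < Cmod f1) by lra.
  assert (HX : Cmod (z - zeta) * Cmod f2 < Cmod f1).
  { pose proof (Cmod_ge_0 (z - zeta)). pose proof (Cmod_ge_0 f2).
    destruct (Rle_lt_or_eq_dec 0 m2 Hm2_0) as [H2|H2].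
    - apply Rle_lt_trans with (Cmod (z - zeta) * m2); [apply Rmult_le_compat_l; lra|].
      apply Rlt_le_trans with (2 * m2); [apply Rmult_lt_compat_r|]; lra.
    - assert (E : Cmod f2 = 0) by lra. rewrite E. lra. }
  assert (Hne : f1 <> RtoC 0).
  { intros E. rewrite E, Cmod_0 in Hf1. lra. }
  pose proof (re_le_Cmod ((z - zeta) * f2 / f1)) as HR.
  assert (HX1 : Cmod ((z - zeta) * f2 / f1) < 1).
  { rewrite Cmod_div, Cmod_mult by auto.
    apply Rmult_lt_reg_r with (Cmod f1); auto. unfold Rdiv.
    rewrite Rmult_assoc, Rinv_l by lra. lra. }
  change (0 < 1 + Re ((z - zeta) * f2 / f1)).
  apply Rabs_le_between in HR. lra.
Qed.

(** * The theorem *)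

Lemma Cmod_pochC_le (x : C) (y : R) (n : nat) : Cmod x <= y -> Cmod (pochC x n) <= pochR y n.
Proof.
intros H. induction n as [|n IH]; simpl.
- rewrite Cmod_1. lra.
- rewrite Cmod_mult. apply Rmult_le_compat; auto using Cmod_ge_0.
  apply Rle_trans with (1 := Cmod_triangle _ _).
  rewrite Cmod_R, Rabs_right by apply Rle_ge, pos_INR. lra.
Qed.

Lemma pochR_quadruple (x : R) (n : nat) :
  pochR (x / 4) n * (pochR ((x + 1) / 4) n * (pochR ((x + 2) / 4) n * pochR ((x + 3) / 4) n))
  * 256 ^ n = pochR x (4 * n).
Proof.
induction n as [|n IH]; [simpl; ring|].
replace (4 * S n)%nat with (S (S (S (S (4 * n))))) by lia.
assert (Hm : INR (4 * n) = 4 * INR n) by (rewrite mult_INR; simpl; ring).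
remember (4 * n)%nat as m. simpl pochR. rewrite <- IH. simpl pow.
change (match m with O => 1 | S _ => INR m + 1 end) with (INR (S m)).
rewrite !S_INR, Hm. field.
Qed.

Definition majorant (alpha beta c : R) (n : nat) : R :=
  binser_coef alpha n * (pochR beta (4 * n) / pochR c (4 * n)).

Lemma majorant_pos (alpha beta c : R) (n : nat) : 0 < alpha -> 0 < beta -> 0 < c ->
  0 < majorant alpha beta c n.
Proof.
intros Ha Hb Hc. apply Rmult_lt_0_compat; [now apply binser_coef_pos|].
apply Rdiv_lt_0_compat; now apply pochR_pos.
Qed.

Lemma majorant_S (alpha beta c : R) (n : nat) : 0 < c ->
  INR (S n) * majorant alpha beta c (S n) =
  alpha * (pochR beta 4 / pochR c 4) * majorant (alpha + 1) (beta + 4) (c + 4) n.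
Proof.
intros Hc. unfold majorant, binser_coef.
replace (4 * S n)%nat with (4 + 4 * n)%nat by lia.
rewrite !(pochR_add _ 4). change (S n) with (1 + n)%nat at 2. rewrite (pochR_add _ 1).
rewrite fact_simpl, mult_INR.
replace (pochR alpha 1) with alpha by (simpl; ring).
change (INR 1) with 1. replace (INR 4) with 4 by (simpl; ring).
pose proof (pochR_pos c 4 Hc). pose proof (pochR_pos (c + 4) (4 * n) ltac:(lra)).
pose proof (INR_fact_lt_0 n). pose proof (lt_0_INR (S n) ltac:(lia)).
field. repeat split; lra.
Qed.

Lemma sum_n_shift_index (F : nat -> R) (N : nat) : (forall n, 0 <= F (S n)) ->
  sum_n (fun n => INR n * F n) N <= sum_n (fun n => INR (S n) * F (S n)) N.
Proof.
intros HF. induction N as [|N IH].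
- rewrite !sum_O. pose proof (HF 0%nat). simpl. lra.
- assert (E : forall M, sum_n (fun n => INR n * F n) (S M) = sum_n (fun n => INR (S n) * F (S n)) M).
  { intros M. induction M as [|M IHM].
    - rewrite sum_Sn, !sum_O. change plus with Rplus. simpl INR at 1. Rring.
    - rewrite sum_Sn, IHM, sum_Sn. reflexivity. }
  rewrite E, sum_Sn. change plus with Rplus.
  assert (0 <= INR (S (S N)) * F (S (S N))) by (apply Rmult_le_pos; auto; apply pos_INR).
  lra.
Qed.

Lemma Cmod_pFq_coef_le (a b : C) (c : R) (n : nat) : 0 < c ->
  Cmod (pFq_coef [a; b / RtoC 4; (b + RtoC 1) / RtoC 4; (b + RtoC 2) / RtoC 4;
                  (b + RtoC 3) / RtoC 4]%C
    [RtoC (c / 4); RtoC ((c + 1) / 4); RtoC ((c + 2) / 4); RtoC ((c + 3) / 4)] n)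
  <= majorant (Cmod a) (Cmod b) c n.
Proof.
intros Hc. unfold pFq_coef; simpl. rewrite !RtoC_pochR, pochR_1.
pose proof (pochR_pos (c / 4) n ltac:(lra)) as C0.
pose proof (pochR_pos ((c + 1) / 4) n ltac:(lra)) as C1.
pose proof (pochR_pos ((c + 2) / 4) n ltac:(lra)) as C2.
pose proof (pochR_pos ((c + 3) / 4) n ltac:(lra)) as C3.
pose proof (INR_fact_lt_0 n) as F0.
rewrite !Cmult_1_r, <- !RtoC_mult.
set (D := pochR (c / 4) n * (pochR ((c + 1) / 4) n * (pochR ((c + 2) / 4) n * pochR ((c + 3) / 4) n))).
assert (HD : 0 < D) by (repeat apply Rmult_lt_0_compat; auto).
rewrite Cmod_div.
2: { intros E. apply RtoC_inj in E. pose proof (Rmult_lt_0_compat _ _ HD F0). lra. }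
rewrite Cmod_R, Rabs_right by (apply Rle_ge, Rlt_le, Rmult_lt_0_compat; auto).
assert (Hq : forall j : R, 0 <= j -> Cmod (pochC ((b + RtoC j) / RtoC 4) n) <= pochR ((Cmod b + j) / 4) n).
{ intros j Hj. apply Cmod_pochC_le.
  rewrite Cmod_div by (intros E; apply RtoC_inj in E; lra).
  rewrite (Cmod_R 4), (Rabs_right 4) by lra. apply Rmult_le_compat_r; [lra|].
  apply Rle_trans with (1 := Cmod_triangle _ _).
  rewrite Cmod_R, Rabs_right; lra. }
pose proof (Hq 0 ltac:(lra)) as H0. rewrite Rplus_0_r, Cplus_0_r in H0.
pose proof (Hq 1 ltac:(lra)) as H1. pose proof (Hq 2 ltac:(lra)) as H2.
pose proof (Hq 3 ltac:(lra)) as H3.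
pose proof (Cmod_pochC_le a _ n (Rle_refl _)) as Ha.
unfold majorant, binser_coef. rewrite <- !pochR_quadruple. fold D.
assert (HP : 0 < 256 ^ n) by (apply pow_lt; lra).
set (X := pochR (Cmod b / 4) n * (pochR ((Cmod b + 1) / 4) n * (pochR ((Cmod b + 2) / 4) n
   * pochR ((Cmod b + 3) / 4) n))).
replace (pochR (Cmod a) n / INR (fact n) * (X * 256 ^ n / (D * 256 ^ n))) with
  (pochR (Cmod a) n * X / (D * INR (fact n))) by (field; lra).
apply Rmult_le_compat_r.
- apply Rlt_le, Rinv_0_lt_compat, Rmult_lt_0_compat; auto.
- rewrite !Cmod_mult. unfold X.
  repeat (apply Rmult_le_compat; auto using Cmod_ge_0;
    try (repeat apply Rmult_le_pos; apply Cmod_ge_0)).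
Qed.

Theorem theorem3p26 :
  forall (a b : C) (c S2 S1 S0 : R),
    a <> RtoC 0 -> b <> RtoC 0 -> 0 < c ->
    Cmod a + Cmod b + 2 < c ->
    is_series (K := C_AbsRing) (V := C_NormedModule)
      (gamma_2F1_term (Cmod a + 2) (Cmod b + 8) (c - Cmod a + 6)) (RtoC S2) ->
    is_series (K := C_AbsRing) (V := C_NormedModule)
      (gamma_2F1_term (Cmod a + 1) (Cmod b + 4) (c - Cmod a + 3)) (RtoC S1) ->
    is_series (K := C_AbsRing) (V := C_NormedModule)
      (gamma_2F1_term (Cmod a) (Cmod b) (c - Cmod a)) (RtoC S0) ->
    Gamma c * Gamma (c - Cmod a - Cmod b)
      / (Gamma (Cmod b) * Gamma (c - Cmod b))
    * (2 * pochR (Cmod a) 2 / pochR (c - Cmod a - Cmod b - 2) 2 * S2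
       + 5 * Cmod a / (c - Cmod a - Cmod b - 1) * S1
       + S0) <= 2 ->
    class_UCV (fun z : C =>
      (z * pFq [a; b / RtoC 4; (b + RtoC 1) / RtoC 4;
                (b + RtoC 2) / RtoC 4; (b + RtoC 3) / RtoC 4]
               [RtoC (c / 4); RtoC ((c + 1) / 4);
                RtoC ((c + 2) / 4); RtoC ((c + 3) / 4)] z)%C).
Proof.
intros a b c S2 S1 S0 Ha0 Hb0 Hc Habc HS2 HS1 HS0 Hle.
set (us := [a; b / RtoC 4; (b + RtoC 1) / RtoC 4; (b + RtoC 2) / RtoC 4; (b + RtoC 3) / RtoC 4]%C).
set (ls := [RtoC (c / 4); RtoC ((c + 1) / 4); RtoC ((c + 2) / 4); RtoC ((c + 3) / 4)]).
assert (HA : forall n, Cmod (pFq_coef us ls n) <= majorant (Cmod a) (Cmod b) c n).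
{ intros n. now apply Cmod_pFq_coef_le. }
assert (HA0 : pFq_coef us ls 0 = RtoC 1).
{ unfold pFq_coef; simpl. field. }
set (A := pFq_coef us ls) in *.
pose proof (proj1 (Cmod_gt_0 a) Ha0) as Ha. pose proof (proj1 (Cmod_gt_0 b) Hb0) as Hb.
change (class_UCV (fun z => (z * CPS A z)%C)).
generalize dependent (Cmod a). generalize dependent (Cmod b). clearbody A.
intros beta Hb al Habc HS2 HS1 HS0 Hle HA Ha.
set (d := c - al - beta - 2) in *. assert (Hd : 0 < d) by (unfold d; lra).
replace (c - al + 6) with (beta + 8 + d) in HS2 by (unfold d; ring).
replace (c - al + 3) with (beta + 4 + (d + 1)) in HS1 by (unfold d; ring).
replace (c - al) with (beta + (d + 1 + 1)) in HS0 by (unfold d; ring).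
assert (X0 := fun N => partial_sum_le_prefactor _ _ _ Ha Hb (ltac:(lra) : 0 < d + 1 + 1) S0 N HS0).
assert (X1 := fun N => partial_sum_le_prefactor _ _ _ (ltac:(lra) : 0 < al + 1)
   (ltac:(lra) : 0 < beta + 4) (ltac:(lra) : 0 < d + 1) S1 N HS1).
assert (X2 := fun N => partial_sum_le_prefactor _ _ _ (ltac:(lra) : 0 < al + 2)
   (ltac:(lra) : 0 < beta + 8) Hd S2 N HS2).
replace (al + beta + (d + 1 + 1)) with c in X0 by (unfold d; ring).
replace (al + 1 + (beta + 4) + (d + 1)) with (c + INR 4) in X1 by (unfold d; simpl; ring).
replace (al + 2 + (beta + 8) + d) with (c + INR 8) in X2 by (unfold d; simpl; ring).
replace (beta + 4) with (beta + INR 4) in X1 by (simpl; ring).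
replace (beta + 8) with (beta + INR 8) in X2 by (simpl; ring).
replace (al + (d + 1 + 1)) with (c - beta) in X0 by (unfold d; ring).
replace (al + 1 + (d + 1)) with (c - beta) in X1 by (unfold d; ring).
replace (al + 2 + d) with (c - beta) in X2 by (unfold d; ring).
replace (c - al - beta) with (d + 1 + 1) in Hle by (unfold d; ring).
replace (d + 1 + 1 - 1) with (d + 1) in Hle by ring.
rewrite !Gamma_poch in X1, X2 by lra.
rewrite !(Gamma_succ (d + 1)), !(Gamma_succ d) in Hle, X0 by lra.
rewrite (Gamma_succ d) in X1 by lra.
fold (majorant al beta c) in X0.
fold (majorant (al + 1) (beta + INR 4) (c + INR 4)) in X1.
fold (majorant (al + 2) (beta + INR 8) (c + INR 8)) in X2.
assert (HB : forall n, 0 < majorant al beta c n) by (intros; now apply majorant_pos).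
set (k1 := al * (pochR beta 4 / pochR c 4)).
set (k2 := (al + 1) * (pochR (beta + INR 4) 4 / pochR (c + INR 4) 4)).
assert (I4 : INR 4 = 4) by (simpl; ring).
assert (I8 : INR 8 = 8) by (simpl; ring).
assert (Hk1 : 0 < k1).
{ apply Rmult_lt_0_compat; auto. apply Rdiv_lt_0_compat; now apply pochR_pos. }
assert (Hk2 : 0 < k2).
{ apply Rmult_lt_0_compat; [lra|]. apply Rdiv_lt_0_compat; apply pochR_pos; lra. }
assert (Y1 : forall N, sum_n (fun n => INR n * majorant al beta c n) N
  <= k1 * sum_n (majorant (al + 1) (beta + INR 4) (c + INR 4)) N).
{ intros N. rewrite <- sum_n_Rmult_l.
  apply Rle_trans with (1 := sum_n_shift_index _ N (fun n => Rlt_le _ _ (HB (S n)))).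
  right. apply sum_n_ext. intros n. rewrite majorant_S, I4 by auto. reflexivity. }
assert (Y2 : forall N, sum_n (fun n => INR n * ((INR n - 1) * majorant al beta c n)) N
  <= k1 * k2 * sum_n (majorant (al + 2) (beta + INR 8) (c + INR 8)) N).
{ intros N.
  assert (HB' : forall n, 0 < majorant (al + 1) (beta + INR 4) (c + INR 4) n).
  { intros n. apply majorant_pos; lra. }
  apply Rle_trans with (sum_n (fun n => INR n * (k1 * majorant (al + 1) (beta + INR 4) (c + INR 4) n)) N).
  - apply Rle_trans with (sum_n (fun n => INR (S n) * ((INR (S n) - 1) * majorant al beta c (S n))) N).
    + apply (sum_n_shift_index (fun n => (INR n - 1) * majorant al beta c n)).
      intros n. rewrite S_INR. apply Rmult_le_pos; [pose proof (pos_INR n); lra|].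
      now apply Rlt_le.
    + right. apply sum_n_ext. intros n.
      transitivity ((INR (S n) - 1) * (INR (S n) * majorant al beta c (S n))); [Rring|].
      rewrite majorant_S, <- I4 by auto. fold k1. rewrite S_INR.
      replace (INR n + 1 - 1) with (INR n) by ring. reflexivity.
  - rewrite (sum_n_ext _ (fun n => k1 * (INR n * majorant (al + 1) (beta + INR 4) (c + INR 4) n)))
      by (intros n; Rring).
    rewrite sum_n_Rmult_l, Rmult_assoc. apply Rmult_le_compat_l; [lra|].
    apply Rle_trans with (1 := sum_n_shift_index _ N (fun n => Rlt_le _ _ (HB' (S n)))).
    rewrite <- sum_n_Rmult_l. right. apply sum_n_ext. intros n.
    rewrite majorant_S by lra. fold k2. rewrite I4, I8.
    replace (al + 1 + 1) with (al + 2) by ring.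
    replace (beta + 4 + 4) with (beta + 8) by ring.
    replace (c + 4 + 4) with (c + 8) by ring. reflexivity. }
assert (Htot : forall N, sum_n (fun n => (INR n + 1) * (2 * INR n + 1) * majorant al beta c n) N <= 2).
{ intros N.
  rewrite (sum_n_ext _ (fun n => 2 * (INR n * ((INR n - 1) * majorant al beta c n))
     + (5 * (INR n * majorant al beta c n) + majorant al beta c n))) by (intros n; Rring).
  rewrite (sum_n_plus (G := R_AbelianMonoid)), (sum_n_plus (G := R_AbelianMonoid)).
  rewrite !sum_n_Rmult_l. change plus with Rplus.
  apply Rle_trans with (2 := Hle).
  pose proof (Gamma_pos c Hc) as G1. pose proof (Gamma_pos d Hd) as G2.
  pose proof (Gamma_pos beta Hb) as G3. pose proof (Gamma_pos (c - beta) ltac:(lra)) as G4.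
  pose proof (pochR_pos beta 4 Hb). pose proof (pochR_pos c 4 Hc).
  pose proof (pochR_pos (beta + INR 4) 4 ltac:(lra)).
  pose proof (pochR_pos (c + INR 4) 4 ltac:(lra)).
  pose proof (Rmult_le_compat_l k1 _ _ ltac:(lra) (X1 N)) as Z1.
  pose proof (Rmult_le_compat_l (k1 * k2) _ _ ltac:(nra) (X2 N)) as Z2.
  pose proof (Y1 N) as W1. pose proof (Y2 N) as W2. pose proof (X0 N) as W0.
  apply Rle_trans with (1 := Rplus_le_compat _ _ _ _
    (Rmult_le_compat_l 2 _ _ ltac:(lra) (Rle_trans _ _ _ W2 Z2))
    (Rplus_le_compat _ _ _ _ (Rmult_le_compat_l 5 _ _ ltac:(lra) (Rle_trans _ _ _ W1 Z1)) W0)).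
  right. unfold k1, k2.
  change 8%nat with (4 + 4)%nat. rewrite !(pochR_add _ 4 4).
  replace (pochR al 2) with (al * (al + 1)) by (simpl; ring).
  replace (pochR d 2) with (d * (d + 1)) by (simpl; ring).
  field. repeat split; lra. }
assert (Hbig : forall n, Cmod (A n) <= (INR n + 1) * (2 * INR n + 1) * Cmod (A n)).
{ intros n. pose proof (pos_INR n). pose proof (Cmod_ge_0 (A n)).
  rewrite <- (Rmult_1_l (Cmod _)) at 1. apply Rmult_le_compat_r; nra. }
assert (HtA : forall N, sum_n (fun n => (INR n + 1) * (2 * INR n + 1) * Cmod (A n)) N <= 2).
{ intros N. apply Rle_trans with (2 := Htot N). apply sum_n_m_le. intros n.
  pose proof (pos_INR n). apply Rmult_le_compat_l; [nra|auto]. }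
assert (HCV : Rbar_le 1 (CV_radius (fun n => Cmod (A n)))).
{ apply Rbar_le_1_CV_radius with 2. intros n.
  rewrite Rabs_right by apply Rle_ge, Cmod_ge_0.
  apply Rle_trans with (1 := Hbig n). apply Rle_trans with (2 := HtA n).
  assert (HN : forall k, 0 <= (INR k + 1) * (2 * INR k + 1) * Cmod (A k)).
  { intros k. apply Rle_trans with (2 := Hbig k). apply Cmod_ge_0. }
  destruct n as [|n]; [rewrite sum_O; lra|]. rewrite sum_Sn. change plus with Rplus.
  assert (0 <= sum_n (fun n => (INR n + 1) * (2 * INR n + 1) * Cmod (A n)) n); [|lra].
  induction n as [|n IH]; [now rewrite sum_O|].
  rewrite sum_Sn. now apply Rplus_le_le_0_compat. }
apply (UCV_of_coefficients _ (PS_incr_1 (K := C_AbsRing) (V := C_NormedModule) A)); auto.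
- intros z Hz. apply (is_pseries_incr_1 (K := C_AbsRing) (V := C_NormedModule)).
  apply ex_Cpseries. apply Rbar_lt_le_trans with (2 := HCV). exact Hz.
- intros N. change (sum_n (fun n => (INR n + 2) * (2 * INR n + 3) * Cmod (A (S n))) N <= 1).
  assert (E : forall M, sum_n (fun n => (INR n + 1) * (2 * INR n + 1) * Cmod (A n)) (S M) =
    1 + sum_n (fun n => (INR n + 2) * (2 * INR n + 3) * Cmod (A (S n))) M).
  { intros M. induction M as [|M IH].
    - rewrite sum_Sn, !sum_O, HA0, Cmod_1. change plus with Rplus. simpl INR. Rring.
    - rewrite sum_Sn, IH, sum_Sn. change plus with Rplus. rewrite !S_INR. Rring. }
  pose proof (HtA (S N)) as H. rewrite E in H. lra.
Qed.
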